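(* Let $\Omega$ be an open subset of $\mathbb{R}^d$; $T>0$; $(\omega(t))_{t\in[0,T]}$ a moving control support in $\Omega$; $(\pi_k)_{k\ge1}$ a family of orthogonal projections defined on $L^2(\Omega)$; $\mathscr U(t,s)$, $0\le s\le t\le T$, an evolution system of contractions on $L^2(\Omega)$; $\delta_1,m_2\ge0$; $\delta_2,c_1,c_1',c_2,c_2',a,b,m_1>0$ with $a<b$ and $0\le\delta_1<\delta_2\le T$; and $E$ a measurable subset of $[\delta_1,\delta_2]$ with positive Lebesgue measure. Assume the uniform spectral estimates $$\forall t\in E,\ \forall g\in L^2(\Omega),\ \forall k\ge1,\quad \|\pi_kg\|_{L^2(\Omega)}\le c_1'e^{c_1k^a}\|\pi_kg\|_{L^2(\omega(t))},$$ and the dissipation estimates with controlled blow-up $$\forall g\in L^2(\Omega),\ \forall k\ge1,\ \forall\,\delta_1\le s<t\le\delta_2,\quad \|(1-\pi_k)\mathscr U(t,s)g\|_{L^2(\Omega)}\le\frac{1}{c_2'(t-s)^{m_2}}e^{-c_2(t-s)^{m_1}k^b}\|g\|_{L^2(\Omega)}.$$ Then there exists a constant $C>0$ such that for a.e. $t^*\in E$, for all $R>0$, there exists $t_0\in(t^*,t^*+R)\cap E$ such that for all $g\in L^2(\Omega)$, $$\|\mathscr U(t_0,t^* )g\|_{L^2(\Omega)}^2\le\exp\Big(\frac{C}{(t_0-t^* )^{\frac{am_1}{b-a}}}\Big)\int_{(t^*,t_0)\cap E}\|\mathscr U(t,t^* )g\|_{L^2(\omega(t))}^2\,dt.$$ In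 particular, there exists a constant $C_1>0$ such that $$\forall g\in L^2(\Omega),\quad\|\mathscr U(T,0)g\|_{L^2(\Omega)}^2\le C_1\int_E\|\mathscr U(t,0)g\|_{L^2(\omega(t))}^2\,dt.$$ More specifically, let $C>0$ be a constant satisfying $$C>c_1^{\frac b{b-a}}c_2^{-\frac a{b-a}}\frac{2^\alpha\beta^\beta}{\gamma^\gamma(\beta-\gamma)^{\beta-\gamma}},$$ where $\gamma=\frac{am_1}{b-a}>0$, $\beta=2\gamma+\frac{abm_1}{(b-a)^2}>0$, $\alpha=\gamma+1+a+\frac{a^2}{b-a}>0$. Then there exists $T_0>0$ such that, if $E=[\delta_1,\delta_2]=[0,T]$ with $0<T\le T_0$, then for all $g\in L^2(\Omega)$, $$\|\mathscr U(T,0)g\|_{L^2(\Omega)}^2\le\exp\Big(\frac{C}{T^{\frac{am_1}{b-a}}}\Big)\int_0^T\|\mathscr U(t,0)g\|_{L^2(\omega(t))}^2\,dt.$$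
   Context: Moving control support on $[0,T]$ in $\Omega$: a family $(\omega(t))_{t\in[0,T]}$ of subsets of $\mathbb{R}^d$ such that $(t,x)\in[0,T]\times\Omega\mapsto1_{\omega(t)}(x)$ is measurable, $1_{\omega(t)}$ being the characteristic function of $\omega(t)$. For $g\in L^2(\Omega)$, $\|g\|_{L^2(\omega(t))}$ denotes the $L^2$ norm of $g$ on $\Omega\cap\omega(t)$. Evolution system of contractions of a Banach space $X$: a two-parameter family of bounded linear operators $\mathscr U(t,s)$, $0\le s\le t\le T$, on $X$ such that (i) $\mathscr U(s,s)=\mathrm{Id}_X$ for $0\le s\le T$ and $\mathscr U(t,r)\mathscr U(r,s)=\mathscr U(t,s)$ for $0\le s\le r\le t\le T$; (ii) $(t,s)\mapsto\mathscr U(t,s)$ is strongly continuous on $0\le s\le t\le T$; (iii) $\|\mathscr U(t,s)\|\le1$ for all $0\le s\le t\le T$. *)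

(* Defs.v *)
From HB Require Import structures.
From mathcomp Require Import all_boot all_order all_algebra.
From mathcomp Require Import complex ring lra.
From mathcomp Require Import all_classical all_reals all_analysis.
From mathcomp Require Import measurable_realfun.

Set Implicit Arguments.
Unset Strict Implicit.
Unset Printing Implicit Defensive.
Import Order.TTheory GRing.Theory Num.Theory.
Import numFieldNormedType.Exports.
Local Open Scope classical_set_scope.
Local Open Scope ring_scope.

(* Lebesgue outer measure on R^d, d = n.+1, by countable covers with half-open
   boxes; the Caratheodory-measurable sets are the Lebesgue-measurable ones. *)
Section lebesgue_outer.
Context (R : realType) (n : nat).
Implicit Types (a b x : 'rV[R]_n.+1) (X : set 'rV[R]_n.+1).

Definition box (B : 'rV[R]_n.+1 * 'rV[R]_n.+1) : set 'rV[R]_n.+1 :=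
  [set x | forall i, B.1 0 i <= x 0 i < B.2 0 i].

Definition box_volume (B : 'rV[R]_n.+1 * 'rV[R]_n.+1) : R :=
  \prod_i Num.max 0 (B.2 0 i - B.1 0 i).

Definition box_cover X : set (nat -> 'rV[R]_n.+1 * 'rV[R]_n.+1) :=
  [set F | X `<=` \bigcup_k box (F k)].

Definition lebesgue_outer X : \bar R :=
  ereal_inf [set (\sum_(k <oo) (box_volume (F k))%:E)%E | F in box_cover X].

Lemma box_volume_ge0 B : 0 <= box_volume B.
Proof. by apply: prodr_ge0 => i _; rewrite le_max lexx. Qed.

Local Open Scope ereal_scope.

Lemma lebesgue_outer_ge0 X : 0 <= lebesgue_outer X.
Proof.
apply: le_ereal_inf_tmp => _ [F _ <-].
by apply: nneseries_ge0 => k _ _; rewrite lee_fin box_volume_ge0.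
Qed.

Lemma lebesgue_outer0 : lebesgue_outer set0 = 0.
Proof.
apply/eqP; rewrite eq_le lebesgue_outer_ge0 andbT.
apply: ereal_inf_lbound; exists (fun=> (0%R, 0%R)) => //.
apply: eseries0 => k _ _ /=; rewrite /box_volume big_ord_recl /=.
by rewrite mxE subr0 maxxx mul0r.
Qed.

Lemma le_lebesgue_outer : {homo lebesgue_outer : A B / A `<=` B >-> A <= B}.
Proof.
move=> A B AB; apply/ereal_inf_le_tmp => _ [F FB <-].
by exists F => //; exact: subset_trans AB FB.
Qed.

Lemma lebesgue_outer_sigma_subadditive : sigma_subadditive lebesgue_outer.
Proof.
move=> A; have [[i ioo]|] := pselect (exists i, lebesgue_outer (A i) = +oo).
  rewrite (eseries_pinfty _ _ ioo) ?leey// => k _.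
  by rewrite -ltNye (lt_le_trans _ (lebesgue_outer_ge0 _)).
rewrite -forallNE => Aoo.
suff add2e (e : {posnum R}) : lebesgue_outer (\bigcup_k A k) <=
    \sum_(i <oo) lebesgue_outer (A i) + e%:num%:E.
  by apply/lee_addgt0Pr => _/posnumP[].
rewrite (le_trans _ (epsilon_trick _ _ _))//; last first.
  by move=> k; exact: lebesgue_outer_ge0.
pose P k B := box_cover (A k) B /\
  \sum_(j <oo) (box_volume (B j))%:E <=
  lebesgue_outer (A k) + (e%:num / (2 ^ k.+1)%:R)%:E.
have [G PG] : {G : nat -> nat -> _ & forall k, P k (G k)}.
  apply: (@choice _ _ P) => k; rewrite /P /lebesgue_outer.
  set S := (X in ereal_inf X); move infS : (ereal_inf S) => iS.
  case: iS infS => [r Sr|Soo|Soo].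
  - have en1 : (0 < e%:num / (2 ^ k.+1)%:R)%R by [].
    have /(lb_ereal_inf_adherent en1) : ereal_inf S \is a fin_num by rewrite Sr.
    move=> [x [B mB muBx] xS].
    by exists B; split => //; rewrite muBx -Sr; exact/ltW.
  - by have := Aoo k; rewrite /lebesgue_outer Soo.
  - by have := lebesgue_outer_ge0 (A k); rewrite /lebesgue_outer Soo.
pose V B := (box_volume B)%:E.
have V0 B : 0 <= V B by rewrite lee_fin box_volume_ge0.
apply: (@le_trans _ _ (\esum_(i in setT) (V \o uncurry G) i)).
  apply: ereal_inf_lbound => /=.
  have /card_esym/ppcard_eqP[f] := card_nat2.
  exists (uncurry G \o f).
    move=> t [i _ /((PG i).1)[j _ Bijt]]; exists (f^-1%FUN (i, j)) => //=.
    by rewrite invK ?inE.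
  rewrite -[LHS]/(\sum_(k <oo) (V \o uncurry G) (f k)).
  rewrite -(esum_pred_image (V \o uncurry G) _ xpredT) ?[fun=> _]set_true//.
    by rewrite image_eq.
  by move=> ? _; exact: V0.
rewrite (_ : esum _ _ = \sum_(i <oo) \sum_(j <oo) V (G i j)); last first.
  pose J : nat -> set (nat * nat) := fun i => [set (i, j) | j in setT].
  rewrite (_ : setT = \bigcup_k J k); last first.
    by rewrite predeqE => -[a b]; split => // _; exists a => //; exists b.
  rewrite esum_bigcupT /=; last 2 first.
    - apply/trivIsetP => i j _ _ ij.
      rewrite predeqE => -[p m] /=; split => //= -[] [_] _ [<-{p} _].
      by move=> [m' _] [] /esym/eqP; rewrite (negbTE ij).
    - by move=> /= [p m]; exact: V0.
  rewrite -(image_id [set: nat]) -fun_true esum_pred_image//; last first.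
    by move=> k _; apply: esum_ge0 => ? _; exact: V0.
  apply: eq_eseriesr => /= j _.
  rewrite -(esum_pred_image (V \o uncurry G) (pair j) predT)//=; last first.
    by move=> ? ? _ _; exact: (@can_inj _ _ _ snd).
  by congr esum; rewrite predeqE => -[a b]; split; move=> [i _ <-]; exists i.
apply: lee_nneseries => [k _ _|k _]; last exact: (PG k).2.
by apply: nneseries_ge0 => j _ _; exact: V0.
Qed.

HB.instance Definition _ := isOuterMeasure.Build R 'rV[R]_n.+1 lebesgue_outer
  lebesgue_outer0 lebesgue_outer_ge0 le_lebesgue_outer
  lebesgue_outer_sigma_subadditive.

End lebesgue_outer.

Section lebesgue_open_measurable.
Context (R : realType) (n : nat).
Local Notation mu := (@lebesgue_outer R n).
Implicit Types (a b x : 'rV[R]_n.+1) (X : set 'rV[R]_n.+1).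

Let half_space (i : 'I_n.+1) (c : R) := [set x : 'rV[R]_n.+1 | x 0 i < c].

Let split_box i (c : R) (B : 'rV[R]_n.+1 * 'rV[R]_n.+1) :
  exists2 B' : ('rV[R]_n.+1 * 'rV[R]_n.+1) * ('rV[R]_n.+1 * 'rV[R]_n.+1),
    (box B `&` half_space i c `<=` box B'.1) /\
    (box B `&` ~` half_space i c `<=` box B'.2) &
    box_volume B'.1 + box_volume B'.2 = box_volume B.
Proof.
pose B2 : 'rV[R]_n.+1 := \row_j if j == i then Num.min (B.2 0 j) c else B.2 0 j.
pose B1 : 'rV[R]_n.+1 := \row_j if j == i then Num.max (B.1 0 j) c else B.1 0 j.
exists ((B.1, B2), (B1, B.2)) => /=.
  split=> x [Bx] /=; rewrite /half_space /= => Hx j; rewrite /= mxE;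
    have /andP[B1x B2x] := Bx j.
  - by rewrite B1x /=; case: eqP => [ji|//]; rewrite lt_min B2x ji.
  - move/negP : Hx; rewrite -leNgt => Hx; rewrite B2x andbT.
    by case: eqP => [ji|//]; rewrite ge_max B1x ji.
rewrite /box_volume /= (bigD1 i)//= [X in _ + X](bigD1 i)//= [RHS](bigD1 i)//=.
rewrite (eq_bigr (fun j => Num.max 0 (B.2 0 j - B.1 0 j))); last first.
  by move=> j /negbTE ji; rewrite mxE ji.
rewrite [X in _ + _ * X](eq_bigr (fun j => Num.max 0 (B.2 0 j - B.1 0 j))); last first.
  by move=> j /negbTE ji; rewrite mxE ji.
rewrite -mulrDl; congr (_ * _); rewrite !mxE eqxx.
move: (B.1 0 i) (B.2 0 i) => u v; rewrite /Num.max /Num.min.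
by case: (ltP v c) => ?; case: (ltP u c) => ?; do ?case: ltP => ?; lra.
Qed.

Let half_space_measurable i c : mu.-cara.-measurable (half_space i c).
Proof.
apply: le_caratheodory_measurable => X.
apply: le_ereal_inf_tmp => _ [F XF <-].
pose P k (B' : ('rV[R]_n.+1 * 'rV[R]_n.+1) * ('rV[R]_n.+1 * 'rV[R]_n.+1)) :=
  ((box (F k) `&` half_space i c `<=` box B'.1) /\
  (box (F k) `&` ~` half_space i c `<=` box B'.2)) /\
  box_volume B'.1 + box_volume B'.2 = box_volume (F k).
have [G HG] : {G : nat -> _ & forall k, P k (G k)}.
  by apply: (@choice _ _ P) => k; have [B' ? ?] := split_box i c (F k); exists B'.
pose V B : \bar R := (@box_volume R n B)%:E.
have V0 B : (0 <= V B)%E by rewrite lee_fin box_volume_ge0.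
rewrite [leRHS](_ : _ = \sum_(k <oo) V (G k).1 + \sum_(k <oo) V (G k).2)%E.
  apply: leeD; apply: ereal_inf_lbound.
  - exists (fun k => (G k).1) => // x [/XF[k _ Fkx] Hx].
    by exists k => //; exact: (HG k).1.1.
  - exists (fun k => (G k).2) => // x [/XF[k _ Fkx] Hx].
    by exists k => //; exact: (HG k).1.2.
rewrite -nneseriesD//; apply: eq_eseriesr => k _.
by rewrite /V -EFinD (HG k).2.
Qed.

Let box_measurable B : mu.-cara.-measurable (@box R n B).
Proof.
rewrite (_ : box B = \bigcap_(i in [set: 'I_n.+1])
    (~` half_space i (B.1 0 i) `&` half_space i (B.2 0 i))); last first.
  apply/seteqP; split=> [x Bx i _|x Hx i]; rewrite /half_space /=.
    by have /andP[/le_gtF B1x B2x] := Bx i; rewrite B1x.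
  by have [/negP] := Hx i I; rewrite /half_space /= -leNgt => -> ->.
apply: fin_bigcap_measurable => // i _; apply: measurableI.
  exact/measurableC/half_space_measurable.
exact: half_space_measurable.
Qed.

Lemma open_lebesgue_measurable (O : set 'rV[R]_n.+1) :
  open O -> mu.-cara.-measurable O.
Proof.
move=> oO.
pose Q (p : 'rV[rat]_n.+1 * 'rV[rat]_n.+1) : 'rV[R]_n.+1 * 'rV[R]_n.+1 :=
  (map_mx ratr p.1, map_mx ratr p.2).
rewrite (_ : O = \bigcup_(p in [set p | box (Q p) `<=` O]) box (Q p)); last first.
  apply/seteqP; split=> [x Ox|x [p pO] /pO//].
  have /nbhs_ballP[e /= e0 xeO] := open_nbhs_nbhs (conj oO Ox).
  have [p1 Hp1] : {p1 : 'I_n.+1 -> rat & forall i, x 0 i - e < ratr (p1 i) < x 0 i}.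
    apply: (@choice _ _ (fun i q => x 0 i - e < ratr q < x 0 i)) => i.
    have [|q] := @rat_in_itvoo R (x 0 i - e) (x 0 i); first by rewrite ltrBlDr ltrDl.
    by rewrite in_itv /=; exists q.
  have [p2 Hp2] : {p2 : 'I_n.+1 -> rat & forall i, x 0 i < ratr (p2 i) < x 0 i + e}.
    apply: (@choice _ _ (fun i q => x 0 i < ratr q < x 0 i + e)) => i.
    have [|q] := @rat_in_itvoo R (x 0 i) (x 0 i + e); first by rewrite ltrDl.
    by rewrite in_itv /=; exists q.
  exists (\row_i p1 i, \row_i p2 i) => /=.
    move=> y By; apply: xeO; split=> // i j; rewrite (ord1 i).
    have := By j; rewrite /= !mxE => /andP[y1 y2].
    have /andP[x1 _] := Hp1 j; have /andP[_ x2] := Hp2 j.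
    rewrite /ball /= ltr_norml ltrBlDl ltrNl opprB ltrBlDr.
    by apply/andP; split; lra.
  move=> i; rewrite !mxE; have /andP[_ /ltW ->] := Hp1 i.
  by have /andP[-> _] := Hp2 i.
rewrite bigcup_mkcond; apply: countable_bigcupT_measurable => // p.
by case: ifP => // _; exact: box_measurable.
Qed.
End lebesgue_open_measurable.

(* L^2 spaces may be real or complex. *)
Variant scalar_field := RealScalars | ComplexScalars.

Definition scalar (R : realType) (k : scalar_field) : numFieldType :=
  match k with RealScalars => R | ComplexScalars => R[i] end.

Section scalar.
Context (R : realType) (k : scalar_field).

Definition sre : scalar R k -> R :=
  match k with RealScalars => id | ComplexScalars => @complex.Re R end.

Definition sim : scalar R k -> R :=
  match k with RealScalars => fun=> 0 | ComplexScalars => @complex.Im R end.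

(* Over the reals the second argument is dropped; it is 0 wherever
   [mk_scalar] is used. *)
Definition mk_scalar : R -> R -> scalar R k :=
  match k with RealScalars => fun a _ => a | ComplexScalars => @Complex R end.

Definition sconj : scalar R k -> scalar R k :=
  match k with RealScalars => id | ComplexScalars => @conjc R end.

(* [`|z|] lives in [scalar R k]; [modulus z] is the same number in [R]. *)
Definition modulus (z : scalar R k) : R := sre `|z|.

End scalar.

Section scalar_theory.
Context (R : realType) (k : scalar_field).
Implicit Types z w : scalar R k.

Lemma sreD z w : sre (z + w) = sre z + sre w.
Proof. by case: k z w => //= -[a b] [c d]. Qed.

Lemma simD z w : sim (z + w) = sim z + sim w.
Proof. by case: k z w => /= [z w|[a b] [c d]//]; rewrite addr0. Qed.

Lemma sreM z w : sre (z * w) = sre z * sre w - sim z * sim w.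
Proof. by case: k z w => /= [z w|[a b] [c d]//]; rewrite mul0r subr0. Qed.

Lemma simM z w : sim (z * w) = sre z * sim w + sim z * sre w.
Proof. by case: k z w => /= [z w|[a b] [c d]//]; rewrite mul0r mulr0 addr0. Qed.

Lemma modulusE z : modulus z = Num.sqrt (sre z ^+ 2 + sim z ^+ 2).
Proof.
case: k z => [z|z]; last exact: (congr1 (@complex.Re R) (normc_def z)).
by rewrite /modulus /= expr0n addr0 sqrtr_sqr.
Qed.

Lemma modulus_ge0 z : 0 <= modulus z.
Proof. by rewrite modulusE sqrtr_ge0. Qed.

Lemma modulus1 : modulus (1 : scalar R k) = 1.
Proof. by rewrite /modulus normr1; case: k. Qed.

Lemma modulus0 : modulus (0 : scalar R k) = 0.
Proof. by rewrite /modulus normr0; case: k. Qed.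

Lemma modulusD z w : modulus (z + w) <= modulus z + modulus w.
Proof.
rewrite /modulus -sreD; have := ler_normD z w.
by case: k z w => //= z w; rewrite lecE => /andP[].
Qed.

Lemma modulusN z : modulus (- z) = modulus z.
Proof. by rewrite /modulus normrN. Qed.

Lemma modulusM z w : modulus (z * w) = modulus z * modulus w.
Proof.
rewrite !modulusE -sqrtrM ?addr_ge0 ?sqr_ge0// sreM simM.
by congr Num.sqrt; ring.
Qed.

Lemma modulusMn z m : modulus (z *+ m) = modulus z *+ m.
Proof.
rewrite /modulus normrMn; elim: m => [|m IH]; first by rewrite !mulr0n; case: k.
by rewrite !mulrS sreD IH.
Qed.

Lemma modulus_eq0 z : modulus z = 0 -> z = 0.
Proof.
move=> /eqP; rewrite modulusE sqrtr_eq0 => h.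
have : sre z ^+ 2 + sim z ^+ 2 == 0.
  by rewrite eq_le h addr_ge0 ?sqr_ge0.
rewrite paddr_eq0 ?sqr_ge0// !sqrf_eq0 => /andP[].
by case: k z h => /= [z _ /eqP//|[a b] /= _ /eqP -> /eqP ->].
Qed.

End scalar_theory.

Section L2_space.
Context d (T : measurableType d) (R : realType).
Variables (mu : {measure set T -> \bar R}) (k : scalar_field).
Local Notation K := (scalar R k).

Definition square_integrable : {pred T -> K} := fun f =>
  `[< [/\ measurable_fun setT (@sre R k \o f),
          measurable_fun setT (@sim R k \o f) &
          (Lnorm mu 2%:E (fun x => (modulus (f x))%:E) < +oo)%E] >].

Local Notation Lmod f := (Lnorm mu 2%:E (fun x => (modulus (f x))%:E)).

Lemma square_integrableP (f : T -> K) : reflect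
  [/\ measurable_fun setT (@sre R k \o f), measurable_fun setT (@sim R k \o f) &
      (Lmod f < +oo)%E]
  (f \in square_integrable).
Proof. exact: asboolP. Qed.

Lemma measurable_modulus (f : T -> K) : f \in square_integrable ->
  measurable_fun setT (fun x => modulus (f x)).
Proof.
move=> /square_integrableP[mr mi _].
under eq_fun do rewrite modulusE.
apply: measurableT_comp => /=.
  by apply: continuous_measurable_fun; exact: sqrt_continuous.
by apply: measurable_funD; apply: measurable_funX.
Qed.

Lemma le_Lnorm2 (f g : T -> R) : measurable_fun setT f -> measurable_fun setT g ->
  (forall x, 0 <= f x <= g x) ->
  (Lnorm mu 2%:E (EFin \o f) <= Lnorm mu 2%:E (EFin \o g))%E.
Proof.
move=> mf mg fg; rewrite unlock; apply: gt0_ler_poweR => //.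
- by rewrite in_itv /= leey integral_ge0.
- by rewrite in_itv /= leey integral_ge0.
apply: ge0_le_integral => //.
- by move=> x _; exact: poweR_ge0.
- apply: (measurableT_comp (measurable_poweR _)).
  by apply: measurableT_comp => //; exact/measurable_EFinP.
- apply: (measurableT_comp (measurable_poweR _)).
  by apply: measurableT_comp => //; exact/measurable_EFinP.
move=> x _ /=; have /andP[f0 fgx] := fg x; have g0 := le_trans f0 fgx.
by rewrite lee_fin !ger0_norm// ge0_ler_powR.
Qed.

Lemma Lnorm_modulusD (f g : T -> K) :
  f \in square_integrable -> g \in square_integrable ->
  measurable_fun setT (fun x => modulus ((f + g) x)) ->
  (Lmod (f + g)%R <= Lmod f + Lmod g)%E.
Proof.
move=> fL gL mfg.
apply: (@le_trans _ _ (Lnorm mu 2%:E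
    (EFin \o ((fun x => modulus (f x)) \+ (fun x => modulus (g x)))%R))).
  apply: le_Lnorm2 => //.
    by apply: measurable_funD; exact: measurable_modulus.
  by move=> x /=; rewrite modulus_ge0 modulusD.
by apply: eminkowski => //; [exact: measurable_modulus..|rewrite lee_fin ler1n].
Qed.

Lemma Lnorm_modulusZ (a : K) (f : T -> K) : f \in square_integrable ->
  (Lmod (a *: f)%R = (modulus a)%:E * Lmod f)%E.
Proof.
move=> fL; have mf := measurable_modulus fL.
have /square_integrableP[_ _ fin] := fL.
have fLfun : (fun x => modulus (f x)) \in Lfun mu 2%:E.
  by rewrite inE; apply/andP; split; rewrite inE.
have two1 : (1 <= 2%:E :> \bar R)%E by rewrite lee_fin ler1n.
have := LnormZ (Lfun_Sub two1 fLfun) (modulus a).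
rewrite ger0_norm ?modulus_ge0// => <-.
by apply: eq_Lnorm => x /=; rewrite modulusM.
Qed.

Lemma square_integrable_submod_closed : submod_closed square_integrable.
Proof.
have smul (a : K) (f : T -> K) : f \in square_integrable ->
    a *: f \in square_integrable.
  move=> fL; have /square_integrableP[mr mi fin] := fL.
  apply/square_integrableP; split.
  - rewrite (_ : _ \o _ = (fun x => sre a * sre (f x) - sim a * sim (f x))).
      by apply: measurable_funB; apply: measurable_funM.
    by apply/funext => x /=; rewrite sreM.
  - rewrite (_ : _ \o _ = (fun x => sre a * sim (f x) + sim a * sre (f x))).
      by apply: measurable_funD; apply: measurable_funM.
    by apply/funext => x /=; rewrite simM.
  - by rewrite Lnorm_modulusZ// lte_mul_pinfty// lee_fin modulus_ge0.
split=> [|a f g /smul{}/(_ a) fL gL].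
  apply/square_integrableP; split.
  - by rewrite (_ : _ \o _ = cst (sre (0 : K))).
  - by rewrite (_ : _ \o _ = cst (sim (0 : K))).
  - rewrite (_ : (fun=> _) = cst 0%E) ?Lnorm0//.
    by apply/funext => x /=; rewrite modulus0.
have /square_integrableP[fr fi ffin] := fL.
have /square_integrableP[gr gi gfin] := gL.
have mr : measurable_fun setT (@sre R k \o (a *: f + g)).
  rewrite (_ : _ \o _ = (fun x => sre ((a *: f) x) + sre (g x))).
    exact: measurable_funD.
  by apply/funext => x /=; rewrite sreD.
have mi : measurable_fun setT (@sim R k \o (a *: f + g)).
  rewrite (_ : _ \o _ = (fun x => sim ((a *: f) x) + sim (g x))).
    exact: measurable_funD.
  by apply/funext => x /=; rewrite simD.
apply/square_integrableP; split=> //.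
apply: le_lt_trans (Lnorm_modulusD fL gL _) _; last by rewrite lte_add_pinfty.
under eq_fun do rewrite modulusE.
apply: measurableT_comp => /=.
  by apply: continuous_measurable_fun; exact: sqrt_continuous.
by apply: measurable_funD; apply: measurable_funX.
Qed.

HB.instance Definition _ := GRing.isSubmodClosed.Build K (T -> K)
  square_integrable square_integrable_submod_closed.

Record L2fun := MkL2fun {
  L2fun_val :> T -> K;
  _ : L2fun_val \in square_integrable
}.

HB.instance Definition _ := [isSub for L2fun_val].
HB.instance Definition _ := [Choice of L2fun by <:].
HB.instance Definition _ := [SubChoice_isSubLmodule of L2fun by <:].

Definition ae_zero : {pred L2fun} := fun f => `[< {ae mu, forall x, f x = 0} >].

Lemma ae_zeroP (f : L2fun) :
  reflect {ae mu, forall x, f x = 0} (f \in ae_zero).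
Proof. exact: asboolP. Qed.

Lemma L2funD (f g : L2fun) x : (f + g) x = f x + g x.
Proof. by []. Qed.

Lemma L2funN (f : L2fun) x : (- f) x = - f x.
Proof. by []. Qed.

Lemma L2funZ a (f : L2fun) x : (a *: f) x = a * f x.
Proof. by []. Qed.

Lemma ae_zero_zmod_closed : zmod_closed ae_zero.
Proof.
split=> [|f g /ae_zeroP f0 /ae_zeroP g0]; apply/ae_zeroP.
  exact: aeW.
by apply: filterS2 f0 g0 => x fx gx; rewrite L2funD L2funN fx gx subr0.
Qed.

HB.instance Definition _ := GRing.isZmodClosed.Build L2fun ae_zero
  ae_zero_zmod_closed.

Definition L2 : Type := Quotient.quot ae_zero.

HB.instance Definition _ := GRing.Zmodule.on L2.
HB.instance Definition _ := ZmodQuotient.on L2.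

Local Open Scope quotient_scope.

Definition L2_scale (a : K) : L2 -> L2 := lift_op1 L2 ( *:%R a).

Lemma pi_L2_scale a : {morph \pi_L2 : f / a *: f >-> L2_scale a f}.
Proof.
move=> f; unlock L2_scale; apply/eqP; rewrite -Quotient.idealrBE -scalerBr.
have : f - repr (\pi_L2 f) \in ae_zero by rewrite Quotient.idealrBE reprK.
move=> /ae_zeroP f0; apply/ae_zeroP; apply: filterS f0 => x fx.
by rewrite L2funZ fx mulr0.
Qed.

Lemma L2_scaleA a b f : L2_scale a (L2_scale b f) = L2_scale (a * b) f.
Proof. by rewrite -[f]reprK -!pi_L2_scale scalerA. Qed.

Lemma L2_scale1 : left_id 1 L2_scale.
Proof. by move=> f; rewrite -[f]reprK -!pi_L2_scale scale1r. Qed.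

Lemma L2_scaleDr : right_distributive L2_scale +%R.
Proof.
by move=> a f g; rewrite -[f]reprK -[g]reprK -raddfD -!pi_L2_scale scalerDr raddfD.
Qed.

Lemma L2_scaleDl f : {morph L2_scale^~ f : a b / a + b}.
Proof.
by move=> a b; rewrite -[f]reprK -!pi_L2_scale scalerDl raddfD.
Qed.

HB.instance Definition _ := GRing.Zmodule_isLmodule.Build K L2
  L2_scaleA L2_scale1 L2_scaleDr L2_scaleDl.

Lemma reprD (f g : L2) :
  {ae mu, forall x, repr (f + g) x = repr f x + repr g x}.
Proof.
have : repr (f + g) - (repr f + repr g) \in ae_zero.
  rewrite Quotient.idealrBE; apply/eqP.
  have : \pi_L2 (repr (f + g)) = \pi_L2 (repr f + repr g).
    by rewrite raddfD /= !reprK.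
  exact.
by move=> /ae_zeroP; apply: filterS => x /eqP; rewrite subr_eq0 => /eqP.
Qed.

Lemma reprZ a (f : L2) : {ae mu, forall x, repr (a *: f) x = a * repr f x}.
Proof.
have : repr (a *: f) - a *: repr f \in ae_zero.
  rewrite Quotient.idealrBE; apply/eqP.
  have : \pi_L2 (repr (a *: f)) = \pi_L2 (a *: repr f).
    by rewrite pi_L2_scale !reprK.
  exact.
by move=> /ae_zeroP; apply: filterS => x /eqP; rewrite subr_eq0 => /eqP.
Qed.

Lemma L2_eq0 (f : L2) : {ae mu, forall x, repr f x = 0} -> f = 0.
Proof.
move=> /ae_zeroP; rewrite -[repr f]subr0 Quotient.idealrBE => /eqP h.
rewrite -[f]reprK -[RHS](raddf0 (\pi_L2)); exact: h.
Qed.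

Definition L2norm (f : L2) : R :=
  fine (Lnorm mu 2%:E (fun x => (modulus (repr f x))%:E)).

Lemma L2normE f : (L2norm f)%:E = Lmod (repr f).
Proof.
have /square_integrableP[_ _ fin] := valP (repr f).
by rewrite fineK// ge0_fin_numE// Lnorm_ge0.
Qed.

Lemma ae_Lnorm (f g : T -> K) : f \in square_integrable ->
  g \in square_integrable -> {ae mu, forall x, f x = g x} -> Lmod f = Lmod g.
Proof.
move=> fL gL fg; rewrite unlock; congr poweR; apply: ae_eq_integral => //.
- apply: (measurableT_comp (measurable_poweR _)).
  by apply: measurableT_comp => //; apply/measurable_EFinP; exact: measurable_modulus.
- apply: (measurableT_comp (measurable_poweR _)).
  by apply: measurableT_comp => //; apply/measurable_EFinP; exact: measurable_modulus.
by apply: filterS fg => x fgx _; rewrite fgx.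
Qed.

Lemma L2normZ a f : L2norm (a *: f) = modulus a * L2norm f.
Proof.
apply: EFin_inj; rewrite EFinM !L2normE -Lnorm_modulusZ ?(valP (repr f))//.
apply: ae_Lnorm; [exact: valP|exact: (valP (a *: repr f))|exact: reprZ].
Qed.

Lemma ler_L2normD f g : L2norm (f + g) <= L2norm f + L2norm g.
Proof.
rewrite -lee_fin EFinD !L2normE.
rewrite (@ae_Lnorm _ (repr f + repr g) (valP _) (valP (repr f + repr g)) (reprD f g)).
apply: Lnorm_modulusD; [exact: valP|exact: valP|].
exact: measurable_modulus (valP (repr f + repr g)).
Qed.

Lemma L2norm_eq0 f : L2norm f = 0 -> f = 0.
Proof.
move=> f0; apply: L2_eq0; have := L2normE f; rewrite f0 => /esym.
move=> /Lnorm_eq0_eq0 h.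
have /measurable_EFinP mf := measurable_modulus (valP (repr f)).
have := h mf (ltr0Sn _ 1).
by apply: filterS => x /(_ I) [/modulus_eq0].
Qed.

Lemma L2normN f : L2norm (- f) = L2norm f.
Proof. by rewrite -scaleN1r L2normZ modulusN modulus1 mul1r. Qed.

Lemma L2normMn f m : L2norm (f *+ m) = L2norm f *+ m.
Proof.
by rewrite -scaler_nat L2normZ modulusMn modulus1 mulr_natl.
Qed.

HB.instance Definition _ := Num.Zmodule_isNormed.Build R L2
  ler_L2normD L2norm_eq0 L2normMn L2normN.
HB.instance Definition _ := PseudoMetric.copy L2 (pseudoMetric_normed L2).
HB.instance Definition _ := isPointed.Build L2 0.
HB.instance Definition _ := NormedZmod_PseudoMetric_eq.Build R L2 erefl.

End L2_space.

Section L2_operators.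
Context d (X : measurableType d) (R : realType).
Variables (mu : {measure set X -> \bar R}) (k : scalar_field).
Local Notation H := (L2 mu k).

Definition L2inner (f g : H) : scalar R k :=
  let h x := repr f x * sconj (repr g x) in
  mk_scalar k (\int[mu]_x sre (h x)) (\int[mu]_x sim (h x)).

Definition orthogonal_projection (P : {linear H -> H}) :=
  (forall f, P (P f) = P f) /\ (forall f g, L2inner (P f) g = L2inner f (P g)).

(* Boundedness of the operators is part of the last clause. The values of [U]
   outside [0 <= s <= t <= T] are irrelevant. *)
Definition evolution_system_of_contractions (T : R)
    (U : R -> R -> {linear H -> H}) :=
  [/\ forall s, 0 <= s -> s <= T -> forall g, U s s g = g,
      forall s r t, 0 <= s -> s <= r -> r <= t -> t <= T ->
        forall g, U t r (U r s g) = U t s g,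
      forall g, {within [set p : R * R | [/\ 0 <= p.2, p.2 <= p.1 & p.1 <= T]],
        continuous (fun p : R * R => U p.1 p.2 g)} &
      forall s t, 0 <= s -> s <= t -> t <= T -> forall g, `|U t s g| <= `|g| ].

Definition dissipation_estimates (delta1 delta2 : R)
    (U : R -> R -> {linear H -> H}) (P : nat -> {linear H -> H})
    (c2 c2' m1 m2 b : R) :=
  forall (g : H) (j : nat), (1 <= j)%N ->
  forall s t, delta1 <= s -> s < t -> t <= delta2 ->
    `|U t s g - P j (U t s g)| <=
      1 / (c2' * (t - s) `^ m2) *
      expR (- (c2 * (t - s) `^ m1 * j%:R `^ b)) * `|g|.

End L2_operators.

(* R, and R^n.+1, with their sigma-algebras of Lebesgue measurable sets. *)
Notation lebesgue_line R := (caratheodory_type (@wlength R idfun)^*%mu).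
Notation lebesgue_space R n := (caratheodory_type (@lebesgue_outer R n)).

Definition line_measure (R : realType) :
  {measure set (lebesgue_line R) -> \bar R} := completed_lebesgue_measure.

Section space_measure.
Context (R : realType) (n : nat).

Definition space_measure : set (lebesgue_space R n) -> \bar R :=
  @lebesgue_outer R n.

Let measure_semi_sigma_additive : semi_sigma_additive space_measure.
Proof. exact: caratheodory_measure_sigma_additive. Qed.

HB.instance Definition _ := isMeasure.Build _ _ _ space_measure
  (@lebesgue_outer0 R n) (@lebesgue_outer_ge0 R n) measure_semi_sigma_additive.

End space_measure.

(* Functions on the whole of R^n.+1 modulo equality a.e. in Omega are the same
   as functions on Omega modulo equality a.e. *)
Definition lebesgue_on (R : realType) (n : nat) (Omega : set 'rV[R]_n.+1)
    (oOmega : open Omega) : {measure set (lebesgue_space R n) -> \bar R} :=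
  mrestr (@space_measure R n) (open_lebesgue_measurable oOmega).

Definition moving_control_support (R : realType) (n : nat) (T : R)
    (Omega : set 'rV[R]_n.+1) (omega : R -> set 'rV[R]_n.+1) :=
  @measurable_fun _ _ (lebesgue_line R * lebesgue_space R n)%type R
    (`[0, T]%classic `*` Omega) (fun p => \1_(omega p.1) p.2).

Notation L2Omega oOmega k := (L2 (lebesgue_on oOmega) k).

Section L2_Omega.
Context (R : realType) (n : nat) (Omega : set 'rV[R]_n.+1).
Variables (oOmega : open Omega) (k : scalar_field).
Local Notation H := (L2Omega oOmega k).

Definition norm_on (A : set 'rV[R]_n.+1) (g : H) : R :=
  fine (Lnorm (lebesgue_on oOmega) 2%:E
    (fun x => (modulus (repr g x) * \1_(Omega `&` A) x)%:E)).

Definition uniform_spectral_estimates (E : set R)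
    (omega : R -> set 'rV[R]_n.+1) (P : nat -> {linear H -> H}) (c1 c1' a : R) :=
  forall t, E t -> forall (g : H) (j : nat), (1 <= j)%N ->
    `|P j g| <= c1' * expR (c1 * j%:R `^ a) * norm_on (omega t) (P j g).

End L2_Omega.

(* Main.v *)
Require Import Defs.
From HB Require Import structures.
From mathcomp Require Import all_boot all_order all_algebra.
From mathcomp Require Import ring lra.
From mathcomp Require Import all_classical all_reals all_analysis.
From mathcomp Require Import measurable_realfun.

Set Implicit Arguments.
Unset Strict Implicit.
Unset Printing Implicit Defensive.
Import Order.TTheory GRing.Theory Num.Theory.
Import numFieldNormedType.Exports.
Local Open Scope classical_set_scope.
Local Open Scope ring_scope.

(** On the geometric grid [l_m = s + q ^ m L] let [tau_m = l_m - l_{m+1}]. For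
    [t] in [E] in the upper half of [[l_{m+1}, l_m]], splitting the state at
    frequency [k] of order [tau_m ^ (- g / a)] and combining the spectral and
    the dissipation estimates gives
    [X l_m <= A_m phi t + B_m X l_{m+1}], where [X] is the norm of the state,
    [phi] the norm on the control support, [A_m = c1' exp (mu tau_m ^ - g)]
    and [B_m] is of order [A_m exp (- nu tau_m ^ - g)]. If
    [mu q ^ - g < nu], the weights [w_m = tau_m / (8 A_m ^ 2)] satisfy
    [2 B_m ^ 2 w_m <= w_{m+1}] for short windows, so the integrated
    inequalities telescope to [w_0 X (s + L) ^ 2 <= \int phi ^ 2], and
    [1 / w_0] is at most [exp (C / L ^ g)] as soon as
    [2 mu (1 - q) ^ - g < C]. The stated lower bound on [C] is the value
    obtained for [q = (beta - g) / beta]. In a general [E], Lebesgue's density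
    theorem lets [E] fill a definite part of every window to the right of
    almost every point of [E]. *)

(** * Small-time asymptotics, choice of the frequency and of the grid ratio *)

(** From [ln (d * x) <= d * x] with [p * d <= eta / 2], the logarithm costs at most half of the
    linear term, and the other half beats the constants. Applied at [x = t ^ - g], this absorbs
    powers of [t] into exponentials of [t ^ - g]. *)
Lemma ln_linear_absorb (R : realType) (p eta N : R) : 0 <= p -> 0 < eta ->
  exists2 x0, 0 < x0 & forall x, x0 <= x -> p * ln x - eta * x <= - N.
Proof.
move=> p0 eta0; pose d := eta / (2 * (p + 1)).
have d0 : 0 < d by rewrite divr_gt0// mulr_gt0//; lra.
(* The [p + 1] in [d], instead of [p], covers [p = 0], which occurs when [m2 = 0]. *)
have pd : p * d <= eta / 2.
  rewrite /d mulrA ler_pdivrMr ?mulr_gt0//; last lra.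
  rewrite (_ : eta / 2 * (2 * (p + 1)) = p * eta + eta); [lra | by field].
exists (Num.max 1 (2 / eta * (N - p * ln d))); first by rewrite lt_max ltr01.
move=> x; rewrite ge_max => /andP[x1 xN].
have x0 : 0 < x by apply: lt_le_trans x1.
have : ln x + ln d <= x * d by rewrite -lnM ?posrE// ltW// ln_sublinear// mulr_gt0.
move=> /(ler_wpM2l p0); rewrite mulrDr => lnx.
have : N - p * ln d <= eta / 2 * x.
  rewrite -ler_pdivrMl ?divr_gt0//; apply: le_trans xN.
  by rewrite invf_div.
have : p * (x * d) <= eta / 2 * x by rewrite mulrCA mulrC ler_wpM2r// ltW.
lra.
Qed.

Lemma powRN_large (R : realType) (g x0 : R) : 0 < g -> 0 < x0 ->
  exists2 t0, 0 < t0 & forall t, 0 < t -> t <= t0 -> x0 <= t `^ (- g).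
Proof.
move=> g0 x00; exists (x0 `^ (- g^-1)); first exact: powR_gt0.
move=> t t0 tx; rewrite powRN -[leLHS]invrK.
rewrite lef_pV2 ?posrE ?invr_gt0//; last exact: powR_gt0.
have -> : x0^-1 = (x0 `^ (- g^-1)) `^ g.
  by rewrite -powRrM mulNr mulVf ?gt_eqF// powR_inv1 ?ltW.
by apply: ge0_ler_powR; rewrite ?nnegrE ?powR_ge0 ?(ltW g0) ?(ltW t0).
Qed.

(** The integer frequency is the rounding up of [(kappa * t ^ (- g)) ^ (1 / a)],
    which is at least [1] for small [t]: rounding costs at most a factor [2],
    whence the factor [2 ^ a]. *)
Lemma near_frequency (R : realType) (c1 c2 a b m1 kappa : R) :
  0 < c1 -> 0 < c2 -> 0 < a -> a < b -> 0 < m1 -> 0 < kappa ->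
  let g := a * m1 / (b - a) in
  exists2 t0, 0 < t0 & forall t, 0 < t -> t <= t0 -> exists j : nat,
  [/\ (1 <= j)%N, c1 * j%:R `^ a <= c1 * 2 `^ a * kappa * t `^ (- g) &
   c2 * 2 `^ (- m1) * kappa `^ (b / a) * t `^ (- g) <=
   c2 * (t / 2) `^ m1 * j%:R `^ b].
Proof.
move=> c10 c20 a0 ab m10 k0 g.
have ba0 : 0 < b - a by rewrite subr_gt0.
have b0 : 0 < b by apply: lt_trans ab.
have g0 : 0 < g by rewrite !mulr_gt0// invr_gt0.
have [|t0 t00 Ht] := @powRN_large R g kappa^-1 g0; first by rewrite invr_gt0.
exists t0 => // t tp /Ht-/(_ tp) kt; set z := t `^ _ in kt *.
have z0 : 0 < z by apply: powR_gt0.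
have kz1 : 1 <= kappa * z by rewrite mulrC -ler_pdivrMr// mul1r.
pose x := (kappa * z) `^ a^-1.
have x1 : 1 <= x by rewrite -(powRr0 (kappa * z)) ler_powR// invr_ge0 ltW.
have x0 : 0 <= x by apply: le_trans x1.
exists (Num.truncn x).+1; have /andP[jx xj] := truncn_itv x0.
have j2x : (Num.truncn x).+1%:R <= 2 * x by rewrite -natr1; lra.
have xa : x `^ a = kappa * z.
  by rewrite -powRrM mulVf ?gt_eqF// powRr1// mulr_ge0// ltW.
have kz0 : 0 <= kappa * z by apply: mulr_ge0; apply: ltW.
have j0 : 0 <= (Num.truncn x).+1%:R :> R by [].
have xbE : x `^ b = (kappa * z) `^ (a^-1 * b) by rewrite powRrM.
move: (_.+1%:R) j0 jx xj j2x => j j0 jx xj j2x.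
have zE : z = t `^ (- g) by []; clearbody x z; split => //.
  rewrite -(mulrA _ kappa) -(mulrA c1) -xa.
  rewrite ler_pM2l//.
  rewrite -(powRM _ _ x0)//.
  by apply: ge0_ler_powR; rewrite ?nnegrE ?(ltW a0) ?(mulr_ge0 _ x0).
rewrite -!mulrA ler_pM2l// powRM ?invr_ge0 ?(ltW tp)//.
have -> : 2^-1 `^ m1 = 2 `^ (- m1) :> R by rewrite -powR_inv1// -powRrM mulN1r.
rewrite [t `^ m1 * _]mulrC -mulrA ler_pM2l ?powR_gt0//.
(* This balance fixes [g]: since [m1 - g * b / a = - g], the dissipation exponent has the same order
   [t ^ - g] as the spectral one. *)
have -> : kappa `^ (b / a) * z = t `^ m1 * x `^ b.
  rewrite xbE powRM ?(ltW k0) ?(ltW z0)// (mulrC a^-1) [RHS]mulrCA.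
  congr (_ * _); rewrite zE -powRrM -powRD; last by rewrite (gt_eqF tp) implybT.
  by congr (_ `^ _); rewrite /g; field; rewrite !gt_eqF.
rewrite ler_pM2l ?powR_gt0//.
by apply: ge0_ler_powR; rewrite ?nnegrE ?(ltW b0)// ltW.
Qed.
Lemma gt0_powRE (R : realType) (x y : R) : 0 < x -> x `^ y = expR (y * ln x).
Proof. by move=> x0; rewrite /powR gt_eqF. Qed.

(** [q] minimizes [q ^ - (beta - g) * (1 - q) ^ - g]. With the
    exponent [g * a / (b - a)], smaller than [beta - g] by [2 * g], the first
    inequality would be an equality. *)
Lemma geometric_rate (R : realType) (c1 c2 a b m1 C : R) :
  0 < c1 -> 0 < c2 -> 0 < a -> a < b -> 0 < m1 ->
  let g := a * m1 / (b - a) in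
  let beta := 2 * g + a * b * m1 / (b - a) ^+ 2 in
  let alpha := g + 1 + a + a ^+ 2 / (b - a) in
  c1 `^ (b / (b - a)) * c2 `^ (- (a / (b - a))) *
    (2 `^ alpha * beta `^ beta / (g `^ g * (beta - g) `^ (beta - g))) < C ->
  exists q kappa : R, [/\ 0 < q, q < 1, 0 < kappa,
    c1 * 2 `^ a * kappa * q `^ (- g) < c2 * 2 `^ (- m1) * kappa `^ (b / a) &
    2 * (c1 * 2 `^ a * kappa) * (1 - q) `^ (- g) < C].
Proof.
move=> c10 c20 a0 ab m10 g beta alpha HC.
have ba0 : 0 < b - a by rewrite subr_gt0.
have b0 : 0 < b by apply: lt_trans ab.
have g0 : 0 < g by rewrite !mulr_gt0// invr_gt0.
have h0 : 0 < a * b * m1 / (b - a) ^+ 2.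
  by rewrite mulr_gt0// ?invr_gt0 ?exprn_gt0// mulr_gt0// mulr_gt0.
have beta0 : 0 < beta by rewrite /beta; lra.
have bg0 : 0 < beta - g by rewrite /beta; lra.
pose q := (beta - g) / beta.
have q0 : 0 < q by rewrite divr_gt0.
have q1E : 1 - q = g / beta by rewrite /q; field; rewrite gt_eqF.
have q1 : 0 < 1 - q by rewrite q1E divr_gt0.
have lnq : ln q = ln (beta - g) - ln beta by rewrite ln_div ?posrE.
have lnq1 : ln (1 - q) = ln g - ln beta by rewrite q1E ln_div ?posrE.
have lnq0 : ln q < 0 by rewrite ln_lt0// q0 -subr_gt0.
(* [K] is [ln kappa]. Its terms without [q] come from equality in the first inequality, whose powers
   of two contribute [a / (b - a) * (a + m1)]. *)
pose K := a / (b - a) * (ln c1 - ln c2) + (g + a ^+ 2 / (b - a)) * ln 2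
          - (beta - g) * ln q.
have c1E : c1 = expR (ln c1) by rewrite lnK ?posrE.
have c2E : c2 = expR (ln c2) by rewrite lnK ?posrE.
have E2 : (2 : R) = expR (ln 2) by rewrite lnK ?posrE.
exists q, (expR K); split; rewrite ?expR_gt0//; first by rewrite -subr_gt0.
  rewrite !gt0_powRE ?expR_gt0// {1}c1E {1}c2E expRK -!expRD ltr_expR -subr_gt0.
  (* The strict margin is the surplus [2 * g] in the exponent of [q], multiplied by [(b - a) / a],
     which gives [2 * m1]. *)
  set d := (X in 0 < X); have -> : d = - ln q * (2 * m1).
    by rewrite /d /K /beta /g; field; rewrite !gt_eqF.
  by rewrite mulr_gt0// ?oppr_gt0// mulr_gt0.
(* For this [q] and [kappa] the quantity to be bounded equals the threshold on [C]; the equality is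
   checked on logarithms. *)
apply: le_lt_trans HC; rewrite le_eqVlt; apply/orP; left; apply/eqP.
rewrite !gt0_powRE// {1}E2 {1}c1E invfM -!expRN -!expRD; congr expR.
rewrite lnq1 /K lnq /alpha.
move: (ln beta) (ln g) (ln (beta - g)) (ln c1) (ln c2) (ln 2) => ? ? ? ? ? ?.
by rewrite /beta /g; field; rewrite !gt_eqF.
Qed.

(** * Costs and weights of a window of length [t] *)

Definition spectral_cost (R : realType) (c1' mu g t : R) : R :=
  c1' * expR (mu * t `^ (- g)).

(** Dissipation acts during at least half of the window, whence the factor [2 ^ m2]. *)
Definition dissipation_rate (R : realType) (c2' m2 nu g t : R) : R :=
  2 `^ m2 / (c2' * t `^ m2) * expR (- (nu * t `^ (- g))).

(** The factor 8 is 4 times 2: the control acts on a set of measure at least [t / 4], and squaring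
    the two-term bound yields [2 * A ^ 2]. *)
Definition window_weight (R : realType) (c1' mu g t : R) : R :=
  t / (8 * spectral_cost c1' mu g t ^+ 2).

Lemma spectral_cost_gt0 (R : realType) (c1' mu g t : R) :
  0 < c1' -> 0 < spectral_cost c1' mu g t.
Proof. by move=> c0; rewrite mulr_gt0 ?expR_gt0. Qed.

Lemma window_weight_gt0 (R : realType) (c1' mu g t : R) :
  0 < c1' -> 0 < t -> 0 < window_weight c1' mu g t.
Proof.
by move=> c0 t0; rewrite divr_gt0// mulr_gt0// exprn_gt0// spectral_cost_gt0.
Qed.

(** With [A], [A'] the costs at [t] and [q * t] and [D] the dissipation rate, it is enough that
    [(1 + A) * D * A' <= q / 2 * A]. The quotient of the left side by [A] is at most a constant
    times [t ^ - m2 * exp (- eta * t ^ - g)], where the gap [eta = nu - mu * q ^ - g] is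
    positive. *)
Lemma window_weight_step (R : realType) (c1' c2' m2 mu nu g q : R) :
  0 < c1' -> 0 < c2' -> 0 <= m2 -> 0 < mu -> 0 < g -> 0 < q -> q < 1 ->
  mu * q `^ (- g) < nu ->
  exists2 t0, 0 < t0 & forall t, 0 < t -> t <= t0 ->
    2 * ((1 + spectral_cost c1' mu g t) * dissipation_rate c2' m2 nu g t) ^+ 2
      * window_weight c1' mu g t <= window_weight c1' mu g (q * t).
Proof.
move=> c10 c20 m20 mu0 g0 q0 q1 munu.
pose eta := nu - mu * q `^ (- g); have eta0 : 0 < eta by rewrite subr_gt0.
pose M := (1 + c1') * (2 `^ m2 / c2').
have M0 : 0 < M by rewrite !mulr_gt0 ?invr_gt0 ?powR_gt0// addr_gt0.
(* The level [ln (M * (2 / q))] is the one for which [M * exp (- level) = q / 2]. *)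
have [|x0 x00 Hx] := @ln_linear_absorb R (m2 / g) eta (ln (M * (2 / q))) _ eta0.
  by rewrite divr_ge0// ltW.
have [t0 t00 Ht] := powRN_large g0 x00.
exists t0 => // t tp /(Ht _ tp) /Hx; set z := t `^ (- g) => Hz.
have z0 : 0 < z by apply: powR_gt0.
have tm2 : (t `^ m2)^-1 = expR (m2 / g * ln z).
  by rewrite gt0_powRE// -expRN /z ln_powR; congr expR; field; rewrite gt_eqF.
rewrite /window_weight.
have : spectral_cost c1' mu g (q * t) = c1' * expR (mu * q `^ (- g) * z).
  by rewrite /spectral_cost powRM ?(ltW q0) ?(ltW tp)// mulrA.
have : dissipation_rate c2' m2 nu g t =
    2 `^ m2 / c2' * expR (m2 / g * ln z - nu * z).
  by rewrite expRD -tm2 mulrA /dissipation_rate invfM !mulrA.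
have : spectral_cost c1' mu g t = c1' * expR (mu * z) by [].
have : 0 < spectral_cost c1' mu g (q * t) by apply: spectral_cost_gt0.
have : 0 < spectral_cost c1' mu g t by apply: spectral_cost_gt0.
have : 0 < dissipation_rate c2' m2 nu g t.
  by rewrite !mulr_gt0 ?invr_gt0 ?expR_gt0 ?mulr_gt0 ?powR_gt0.
have ME : M = (1 + c1') * (2 `^ m2 / c2') by [].
have etaE : eta = nu - mu * q `^ (- g) by [].
clearbody z M eta; move: (spectral_cost _ _ _ t) (spectral_cost _ _ _ (q * t)).
move: (dissipation_rate _ _ _ _ _) => D A A' D0 A0 A'0 AE DE A'E.
have qt0 : 0 < q * t by apply: mulr_gt0.
have BA : (1 + A) * D * A' <= q / 2 * A.
  have A1 : 1 + A <= (1 + c1') * expR (mu * z).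
    rewrite AE mulrDl mul1r lerD2r -expR0 ler_expR.
    by rewrite mulr_ge0// ltW.
  apply: (@le_trans _ _ ((1 + c1') * expR (mu * z) * D * A')).
    by rewrite ler_pM2r// ler_pM2r.
  have -> : (1 + c1') * expR (mu * z) * D * A' =
      M * expR (m2 / g * ln z - eta * z) * A.
    have -> : m2 / g * ln z - eta * z =
        m2 / g * ln z - nu * z + mu * q `^ (- g) * z by rewrite etaE; ring.
    by rewrite expRD DE A'E AE ME; ring.
  rewrite ler_pM2r//.
  apply: (@le_trans _ _ (M * expR (- ln (M * (2 / q))))).
    by rewrite ler_pM2l// ler_expR.
  have Mq : 0 < M * (2 / q) by rewrite mulr_gt0// divr_gt0.
  rewrite expRN (lnK Mq) invfM mulrA divff ?gt_eqF// mul1r.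
  by rewrite invf_div.
have B0 : 0 <= (1 + A) * D * A'.
  by rewrite ltW// !mulr_gt0// addr_gt0.
have BA2 : ((1 + A) * D * A') ^+ 2 <= (q / 2 * A) ^+ 2.
  by rewrite lerXn2r// nnegrE// (le_trans B0).
rewrite mulrA ler_pdivrMr ?mulr_gt0 ?exprn_gt0//.
rewrite [leRHS]mulrAC ler_pdivlMr ?mulr_gt0 ?exprn_gt0//.
rewrite (_ : _ * _ = 16 * t * ((1 + A) * D * A') ^+ 2); last by ring.
apply: (@le_trans _ _ (16 * t * (q / 2 * A) ^+ 2)).
  by rewrite ler_pM2l// mulr_gt0.
rewrite (_ : 16 * t * _ = q * t * (8 * A ^+ 2) * (q / 2)); last by field.
apply: ler_piMr; last lra.
by rewrite ltW// !mulr_gt0// exprn_gt0.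
Qed.

(** The inverse of the first weight is [M / L] times [exp (2 * mu * (1 - q) ^ - g * L ^ - g)]. The
    strict inequality on [C] leaves an exponential that absorbs [M / L] when [L] is small. *)
Lemma window_weight_init (R : realType) (c1' mu g q C : R) :
  0 < c1' -> 0 < g -> 0 < q -> q < 1 -> 2 * mu * (1 - q) `^ (- g) < C ->
  exists2 L0, 0 < L0 & forall L, 0 < L -> L <= L0 ->
    1 <= expR (C / L `^ g) * window_weight c1' mu g ((1 - q) * L).
Proof.
move=> c10 g0 q0 q1 HC.
have p0 : 0 < 1 - q by rewrite subr_gt0.
pose eta := C - 2 * mu * (1 - q) `^ (- g); have eta0 : 0 < eta by rewrite subr_gt0.
pose M := 8 * c1' ^+ 2 / (1 - q).
have M0 : 0 < M by rewrite divr_gt0// mulr_gt0// exprn_gt0.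
have [|x0 x00 Hx] := @ln_linear_absorb R g^-1 eta (ln M) _ eta0.
  by rewrite invr_ge0 ltW.
have [t0 t00 Ht] := powRN_large g0 x00.
exists t0 => // L Lp /(Ht _ Lp) /Hx; rewrite -powRN; set z := L `^ (- g) => Hz.
have z0 : 0 < z by apply: powR_gt0.
have LE : L = expR (- (g^-1 * ln z)).
  rewrite /z ln_powR -[LHS]lnK ?posrE//; congr expR; field; rewrite gt_eqF//.
rewrite /window_weight /spectral_cost powRM ?(ltW p0) ?(ltW Lp)// -/z.
have -> : expR (C * z) * ((1 - q) * L / (8 * (c1' * expR (mu *
   ((1 - q) `^ (- g) * z))) ^+ 2)) = M^-1 * expR (- (g^-1 * ln z - eta * z)).
  rewrite {1}LE opprB [eta * z - _]addrC expRD.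
  have -> : eta * z = C * z - (mu * ((1 - q) `^ (- g) * z)) * 2.
    by rewrite /eta; ring.
  have e2 u : expR (u * 2) = expR u ^+ 2 :> R.
    by rewrite expr2 -expRD; congr expR; ring.
  rewrite expRD [expR (- (_ * 2))]expRN e2 /M; field.
  by rewrite gt_eqF ?expR_gt0// !gt_eqF.
rewrite ler_pdivlMl// mulr1 -[leLHS]lnK ?posrE// ler_expR; lra.
Qed.

(** * Lower bounds for integrals *)

(** No measurability is needed: for a nonnegative function the integral is the
    supremum over the simple functions below it. The observation
    [t |-> norm_on (omega t) (U t s g)] is never shown to be measurable. *)
Lemma le_integral_restrict d (T : measurableType d) (R : realType)
    (mu : {measure set T -> \bar R}) (A B : set T) (f g : T -> \bar R) :
  A `<=` B -> (forall x, B x -> 0 <= g x)%E ->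
  (forall x, A x -> 0 <= f x <= g x)%E ->
  (\int[mu]_(x in A) f x <= \int[mu]_(x in B) g x)%E.
Proof.
move=> AB g0 fg; have f0 x : A x -> (0 <= f x)%E by move=> /fg/andP[].
rewrite (ge0_integralE mu f0) (ge0_integralE mu g0).
apply: ereal_sup_le => _ [h /= hf <-]; exists h => //= x.
apply: le_trans (hf x) _; rewrite /patch.
case: ifPn => [/set_mem Ax|_]; last by case: ifPn => // /set_mem/g0.
by rewrite (mem_set (AB _ Ax)); have /andP[] := fg _ Ax.
Qed.

(** As the sets [J m] are disjoint, the step function with value [c m] on [J m] lies below [f], and
    its integral is the sum on the left. *)
Lemma le_sum_integral d (T : measurableType d) (R : realType)
    (mu : {measure set T -> \bar R}) (D : set T) (f : T -> \bar R)
    (J : nat -> set T) (c : nat -> R) (N : nat) :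
  (forall m, measurable (J m)) -> trivIset setT J -> (forall m, J m `<=` D) ->
  (forall m, 0 <= c m) -> (forall x, D x -> 0 <= f x)%E ->
  (forall m x, J m x -> ((c m)%:E <= f x)%E) ->
  (\sum_(m < N) (c m)%:E * mu (J m) <= \int[mu]_(x in D) f x)%E.
Proof.
move=> mJ tJ JD c0 f0 cf.
rewrite (_ : \sum_(m < N) _ =
    \int[mu]_x (\sum_(m < N) (c m)%:E * (\1_(J m) x)%:E))%E.
  rewrite [X in (_ <= X)%E]integral_mkcond.
  apply: le_integral_restrict => // x _; rewrite /patch.
    by case: ifPn => // /set_mem/f0.
  apply/andP; split; first by apply: sume_ge0 => m _; rewrite mule_ge0 ?lee_fin.
  have [[m Jmx]|nJ] := pselect (exists m : 'I_N, J m x).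
    rewrite (bigD1 m)//= indicE mem_set// mule1 big1 ?adde0.
      by rewrite (mem_set (JD _ _ Jmx)); exact: cf.
    move=> k km; rewrite indicE memNset ?mule0// => Jkx.
    have /eqP : val k <> val m by move=> /val_inj kE; move: km; rewrite kE eqxx.
    by apply/negP; rewrite negbK; apply/eqP; apply: (tJ _ _ I I); exists x.
  rewrite big1 => [|k _]; first by case: ifPn => // /set_mem/f0.
  by rewrite indicE memNset ?mule0// => Jkx; apply: nJ; exists k.
rewrite ge0_integral_sum//; last 2 first.
- by move=> k; apply: measurable_funeM; apply/measurable_EFinP.
- by move=> k x _; rewrite mule_ge0 ?lee_fin.
apply: eq_bigr => k _; rewrite ge0_integralZl_EFin//.
  by rewrite integral_indic// setIT.
by apply/measurable_EFinP.
Qed.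

(** * Lebesgue measure on the line and one-sided density *)

Lemma line_measureE (R : realType) (A : set R) :
  line_measure R A = lebesgue_measure A.
Proof. by []. Qed.

Lemma measurable_line (R : realType) (A : set R) :
  measurable A -> measurable (A : set (lebesgue_line R)).
Proof. exact: sub_caratheodory. Qed.

Lemma line_measure_itv_co (R : realType) (x y : R) : x <= y ->
  line_measure R `[x, y[%classic = (y - x)%:E.
Proof.
move=> xy; rewrite line_measureE lebesgue_measure_itv /= lte_fin.
by case: ltgtP xy => // -> _; rewrite subrr.
Qed.

(** A Lebesgue measurable [E] is a Borel set [B] up to a negligible [N]. The density theorem is
    applied to [B], the points of [N] join the exceptional set, and what the right half of a ball
    misses is at most what the whole ball misses. *)
Lemma density_right (R : realType) (E : set (lebesgue_line R)) (eps : R) :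
  measurable E -> 0 < eps ->
  {ae line_measure R, forall t, E t -> exists2 r0, 0 < r0 &
    forall r, 0 < r -> r <= r0 ->
      (line_measure R (`]t, (t + r)%R[%classic `\` E) <= (eps * r)%:E)%E}.
Proof.
move=> mE eps0.
have : (completed_algebra_gen (@lebesgue_measure R)).-sigma.-measurable E.
  by rewrite completed_caratheodory_measurable.
rewrite g_sigma_completed_algebra_genE => -[B mB [N negN BNE]].
have aeD := lebesgue_density mB.
have [M [mM M0 NM]] : (lebesgue_measure).-negligible (N `|`
  ~` [set x : R | lebesgue_measure (B `&` ball x r) * (lebesgue_measure (ball x r))^-1
     @[r --> 0^'+] --> (\1_B x)%:E])%E.
  exact: negligibleU.
exists M; split => //; first exact: measurable_line.
move=> t /= nEt; apply: NM => /=; apply: contrapT => /not_orP[nNt /contrapT Bt].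
apply: nEt => Et; have Btt : B t by move: Et; rewrite -BNE => -[|/nNt].
move: Bt; rewrite indicE mem_set//= => /fine_cvgP[fB].
(* The ball has measure [2 * r], so a density above [1 - eps / 2] leaves less than [eps * r] outside
   [B]. *)
have e1 : 1 - eps / 2 < 1 :> R by lra.
move=> /cvgr_gt/(_ _ e1) gB.
have [e /= e0 He] : \forall r \near 0^'+,
    (lebesgue_measure (`]t, (t + r)%R[%classic `\` B) <= (eps * r)%:E)%E.
  near=> r; have r0 : 0 < r by near: r; exact: nbhs_right_gt.
  apply: (@le_trans _ _ (lebesgue_measure (ball t r `\` B))).
    apply: le_measure; rewrite ?inE.
    - exact: measurableD.
    - by apply: measurableD => //; exact: measurable_ball.
    - apply: setSD => x /=; rewrite in_itv /= => /andP[tx xr].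
      by rewrite /ball /= distrC ger0_norm ?subr_ge0 ?(ltW tx)// ltrBlDl.
  have mball : lebesgue_measure (ball t r) = (r *+ 2)%:E.
    by rewrite lebesgue_measure_ball// ltW.
  have mboo : (lebesgue_measure (ball t r) < +oo)%E by rewrite mball ltry.
  have : 1 - eps / 2 < fine (lebesgue_measure (B `&` ball t r) *
      (lebesgue_measure (ball t r))^-1)%E by near: r.
  have fBr : lebesgue_measure (B `&` ball t r) \is a fin_num.
    rewrite ge0_fin_numE//; apply: (@le_lt_trans _ _ (lebesgue_measure (ball t r))).
      by apply: le_measure; rewrite ?inE//; [apply: measurableI => //|];
        exact: measurable_ball.
    by rewrite mball ltry.
  have -> : lebesgue_measure (ball t r `\` B) =
      (lebesgue_measure (ball t r) - lebesgue_measure (B `&` ball t r))%E.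
    by rewrite setIC; apply: measureD => //; exact: measurable_ball.
  rewrite -(fineK fBr) mball inver mulrn_eq0 /= gt_eqF//.
  rewrite -EFinM -EFinB lee_fin /= ltr_pdivlMr ?mulrn_wgt0// => hr.
  by move: hr; rewrite -(mulr_natr r 2); lra.
(* Halving turns the strict bound [r < e] of the neighbourhood into a closed one. *)
exists (e / 2); first by rewrite divr_gt0.
move=> r r0 re; apply: le_trans (He r _ r0).
  rewrite -line_measureE; apply: le_measure; rewrite ?inE.
  - by apply: measurableD => //; exact: measurable_line.
  - by apply: measurable_line; exact: measurableD.
  - by rewrite -BNE; apply: setDS => x; left.
by rewrite /ball_ /= sub0r normrN gtr0_norm//; lra.
Unshelve. all: by end_near. Qed.

(** * The inequality on one window and its summation over the grid *)

(** The bounds indexed by [j] are used at the frequency adapted to [t]. Here [x] stands for the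
    state, [y] for its observation, [z] for the state at the bottom of the window and [s] for the
    time elapsed since then. *)
Lemma window_interpolation (R : realType)
    (c1 c1' c2 c2' a b m1 m2 kappa : R) :
  0 < c1 -> 0 < c1' -> 0 < c2 -> 0 < c2' -> 0 < a -> a < b -> 0 < m1 ->
  0 <= m2 -> 0 < kappa ->
  let g := a * m1 / (b - a) in
  let mu := c1 * 2 `^ a * kappa in
  let nu := c2 * 2 `^ (- m1) * kappa `^ (b / a) in
  exists2 t0, 0 < t0 & forall t s x y z, 0 < t -> t <= t0 -> t / 2 <= s ->
    0 <= y -> 0 <= z ->
    (forall j, (1 <= j)%N ->
       x <= c1' * expR (c1 * j%:R `^ a) * y +
         (1 + c1' * expR (c1 * j%:R `^ a)) *
         (1 / (c2' * s `^ m2) * expR (- (c2 * s `^ m1 * j%:R `^ b))) * z) ->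
    x <= spectral_cost c1' mu g t * y +
      (1 + spectral_cost c1' mu g t) * dissipation_rate c2' m2 nu g t * z.
Proof.
move=> c10 c1'0 c20 c2'0 a0 ab m10 m20 k0 g mu nu.
have [t0 t00 Ht] := near_frequency c10 c20 a0 ab m10 k0.
rewrite -/g -/mu -/nu in Ht; clearbody g mu nu.
exists t0 => // t s x y z tp /(Ht _ tp)[j [j1 jmu nuj]] ts y0 z0 /(_ j j1) xE.
apply: le_trans xE _.
have t20 : 0 < t / 2 by rewrite divr_gt0.
have s0 : 0 < s by apply: lt_le_trans ts.
have AA : c1' * expR (c1 * j%:R `^ a) <= spectral_cost c1' mu g t.
  by rewrite ler_pM2l// ler_expR.
have A0 : 0 < c1' * expR (c1 * j%:R `^ a) by rewrite mulr_gt0// expR_gt0.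
apply: lerD; first by apply: ler_wpM2r.
apply: ler_wpM2r => //; apply: ler_pM; rewrite ?lerD2l//.
- by rewrite addr_ge0// ltW.
- by rewrite mulr_ge0 ?expR_ge0// divr_ge0// mulr_ge0 ?powR_ge0// ltW.
apply: ler_pM; rewrite ?expR_ge0//.
- by rewrite divr_ge0// mulr_ge0 ?powR_ge0// ltW.
- have -> : 2 `^ m2 / (c2' * t `^ m2) = 1 / (c2' * (t / 2) `^ m2).
    rewrite powRM ?invr_ge0 ?(ltW tp)//.
    have -> : 2^-1 `^ m2 = (2 `^ m2)^-1 :> R.
      by rewrite -powRN -powR_inv1// -powRrM mulN1r.
    by field; rewrite !gt_eqF// powR_gt0.
  rewrite !div1r lef_pV2 ?posrE ?mulr_gt0 ?powR_gt0// ler_pM2l//.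
  by apply: ge0_ler_powR => //; rewrite nnegrE ltW.
rewrite ler_expR lerN2; apply: le_trans nuj _.
apply: ler_wpM2r; first exact: powR_ge0.
by rewrite ler_pM2l//; apply: ge0_ler_powR; rewrite ?nnegrE ?(ltW m10)// ltW.
Qed.

Lemma geometric_tail_le (R : realType) (q K x y : R) : 0 < q -> q < 1 ->
  (forall N : nat, x - q ^+ N * K <= y) -> x <= y.
Proof.
move=> q0 q1 xy.
have cv : (fun N => x - q ^+ N * K) @ \oo --> x - 0 * K.
  by apply: cvgB; [exact: cvg_cst|apply: cvgMl; apply: cvg_expr; rewrite gtr0_norm].
rewrite -[x]subr0 -[0](mul0r K); apply: cvgr_to_le cv _.
by apply: nearW.
Qed.

(** The upper half of the window with index [m] has length [(1 - q) * q ^ m * L / 2]. The density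
    bound at [r = q ^ m * L] lets [E] miss at most half of it, so [E] keeps the measure that
    multiplies [c m]; these halves are disjoint. *)
Lemma telescoping_integral (R : realType) (q s L eps : R)
    (E : set (lebesgue_line R)) (c : nat -> R) (phi : R -> R) :
  0 < q -> q < 1 -> 0 < L -> eps <= (1 - q) / 4 ->
  measurable E -> (forall t, 0 <= phi t) ->
  (forall r, 0 < r -> r <= L ->
     (line_measure R (`]s, (s + r)%R[%classic `\` E) <= (eps * r)%:E)%E) ->
  (forall m, 0 <= c m) ->
  (forall m t, E t -> s + q ^+ m.+1 * L + (1 - q) * (q ^+ m * L) / 2 <= t ->
     t < s + q ^+ m * L -> c m <= phi t) ->
  forall N, (\sum_(m < N) ((1 - q) * (q ^+ m * L) / 4 * c m)%:E <=
    \int[line_measure R]_(t in `]s, (s + L)%R[%classic `&` E) (phi t)%:E)%E.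
Proof.
move=> q0 q1 L0 epsq mE phi0 dE c0 cphi N.
have p0 : 0 < 1 - q by rewrite subr_gt0.
have l0 m : 0 < q ^+ m * L by rewrite mulr_gt0// exprn_gt0.
(* [u m] is the midpoint and [v m] the upper end of the window. *)
pose u m := s + q ^+ m.+1 * L + (1 - q) * (q ^+ m * L) / 2.
pose v m := s + q ^+ m * L.
have uv m : v m - u m = (1 - q) * (q ^+ m * L) / 2.
  by rewrite /u /v exprS; field.
have uv0 m : 0 < v m - u m by rewrite uv divr_gt0// mulr_gt0.
have su m : v m.+1 < u m by rewrite /u ltrDl divr_gt0// mulr_gt0.
pose J m : set (lebesgue_line R) := `[u m, v m[%classic `&` E.
have mitv x1 x2 : measurable (`[x1, x2[%classic : set (lebesgue_line R)).
  exact: measurable_line.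
have mitv' x1 x2 : measurable (`]x1, x2[%classic : set (lebesgue_line R)).
  exact: measurable_line.
have mJ m : measurable (J m) by apply: measurableI.
have vle m k : (m <= k)%N -> v k <= v m.
  move=> mk; rewrite lerD2l ler_pM2r//; apply: ler_wiXn2l => //; exact: ltW.
have tJ : trivIset setT J.
  suff H m k : (m < k)%N -> J m `&` J k = set0.
    move=> m k _ _ [t [Jm Jk]]; have [mk|km|//] := ltngtP m k.
    - by have := H _ _ mk; rewrite -subset0 => /(_ t); case.
    - by have := H _ _ km; rewrite -subset0 => /(_ t); case.
  move=> mk; rewrite -subset0 => t [[+ _] [+ _]]; rewrite /= !in_itv /=.
  move=> /andP[um _] /andP[_ vk].
  by have := vle _ _ mk; have := su m; lra.
have Jmeas m : (((1 - q) * (q ^+ m * L) / 4)%:E <= line_measure R (J m))%E.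
  have lL : q ^+ m * L <= L.
    by have := vle 0%N m (leq0n _); rewrite /v expr0 mul1r lerD2l.
  have dEm : (line_measure R (`[u m, v m[%classic `\` E) <=
      ((1 - q) * (q ^+ m * L) / 4)%:E)%E.
    apply: (@le_trans _ _ (eps * (q ^+ m * L))%:E).
      apply: le_trans (dE _ (l0 m) lL); apply: le_measure; rewrite ?inE.
      - exact: measurableD.
      - exact: measurableD.
      apply: setSD => t /=; rewrite !in_itv /= => /andP[ut ->]; rewrite andbT.
      by have := su m; have := l0 m.+1; rewrite /v; lra.
    rewrite lee_fin [leRHS](_ : _ = (1 - q) / 4 * (q ^+ m * L)); last by field.
    by rewrite ler_pM2r.
  (* With the admissible loss added on both sides, the left side is the measure of the half window,
     which [E] splits into [J m] and the missed part. *)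
  rewrite -(@leeD2lE _ ((1 - q) * (q ^+ m * L) / 4)%:E)// -EFinD.
  rewrite [leLHS](_ : _ = line_measure R `[u m, v m[%classic); last first.
    rewrite line_measure_itv_co; last by rewrite -subr_ge0 ltW.
    by rewrite uv; congr EFin; field.
  rewrite (measureDI (line_measure R) (mitv (u m) (v m)) mE) -/(J m).
  exact: leeD2r.
have JD m : J m `<=` `]s, (s + L)%R[%classic `&` E.
  move=> t [/= + Et]; rewrite !in_itv /= => /andP[ut tv]; split => //.
  apply/andP; split.
    by have := su m; have := l0 m.+1; rewrite /v; lra.
  have v0 : v 0%N = s + L by rewrite /v expr0 mul1r.
  by have := vle 0%N m (leq0n _); rewrite v0; apply: lt_le_trans.
apply: le_trans (le_sum_integral (line_measure R) N mJ tJ JD c0 _ _); last 2 first.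
- by move=> t _; rewrite lee_fin.
- by move=> m t [/=]; rewrite in_itv /= => /andP[ut vt] Et; rewrite lee_fin cphi.
apply: lee_sum => m _; rewrite muleC EFinM; apply: lee_wpmul2r => //.
by rewrite lee_fin.
Qed.

Lemma le_sqr_affine (R : realFieldType) (A B x y z : R) :
  0 <= x -> x <= A * y + B * z ->
  x ^+ 2 <= 2 * A ^+ 2 * y ^+ 2 + 2 * B ^+ 2 * z ^+ 2.
Proof.
move=> x0 xyz; apply: (@le_trans _ _ ((A * y + B * z) ^+ 2)).
  by rewrite lerXn2r// nnegrE// (le_trans x0).
rewrite -subr_ge0 (_ : _ - _ = (A * y - B * z) ^+ 2); first exact: sqr_ge0.
by ring.
Qed.

(** One step of the telescoping: the loss [B * w * x'] of a window is paid by the weight [w'] of the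
    next one. *)
Lemma weighted_step (R : realFieldType) (w w' B x x' y z : R) :
  w * (x - B * x') <= y -> B * w <= w' -> 0 <= x' ->
  z - w' * x' - y <= z - w * x.
Proof. by move=> wy /ler_wpM2r Bw /Bw; lra. Qed.

(** Only two functions of time remain, [X] for the norm of the state and [phi] for that of the
    observation. [eps] and [L0] are chosen from the constants alone, before the set, the window and
    the functions. *)
Lemma scalar_observability (R : realType)
    (c1 c1' c2 c2' a b m1 m2 C : R) :
  0 < c1 -> 0 < c1' -> 0 < c2 -> 0 < c2' -> 0 < a -> a < b -> 0 < m1 ->
  0 <= m2 ->
  let g := a * m1 / (b - a) in
  let beta := 2 * g + a * b * m1 / (b - a) ^+ 2 in
  let alpha := g + 1 + a + a ^+ 2 / (b - a) in
  c1 `^ (b / (b - a)) * c2 `^ (- (a / (b - a))) *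
    (2 `^ alpha * beta `^ beta / (g `^ g * (beta - g) `^ (beta - g))) < C ->
  exists eps L0 : R, [/\ 0 < eps, 0 < L0 &
    forall (E : set (lebesgue_line R)) (s L : R) (X phi : R -> R),
    measurable E -> 0 < L -> L <= L0 ->
    (forall r, 0 < r -> r <= L ->
      (line_measure R (`]s, (s + r)%R[%classic `\` E) <= (eps * r)%:E)%E) ->
    (forall t, 0 <= X t) -> (forall t, 0 <= phi t) ->
    (forall u t, s <= u -> u <= t -> t <= s + L -> X t <= X u) ->
    (forall u t j, (1 <= j)%N -> s <= u -> u < t -> t < s + L -> E t ->
       X t <= c1' * expR (c1 * j%:R `^ a) * phi t +
         (1 + c1' * expR (c1 * j%:R `^ a)) *
         (1 / (c2' * (t - u) `^ m2) *
          expR (- (c2 * (t - u) `^ m1 * j%:R `^ b))) * X u) ->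
    ((X (s + L) ^+ 2)%:E <= (expR (C / L `^ g))%:E *
      \int[line_measure R]_(t in `]s, (s + L)%R[%classic `&` E)
        (phi t ^+ 2)%:E)%E].
Proof.
move=> c10 c1'0 c20 c2'0 a0 ab m10 m20 g beta alpha HC.
have [q [kappa [q0 q1 k0 munu muC]]] := geometric_rate c10 c20 a0 ab m10 HC.
rewrite -/g in munu muC.
have ba0 : 0 < b - a by rewrite subr_gt0.
have g0 : 0 < g by rewrite !mulr_gt0// invr_gt0.
set mu := c1 * 2 `^ a * kappa in munu muC.
set nu := c2 * 2 `^ (- m1) * kappa `^ (b / a) in munu.
have mu0 : 0 < mu by rewrite !mulr_gt0 ?powR_gt0.
have p0 : 0 < 1 - q by rewrite subr_gt0.
have [t1 t10 Hint] :=
  window_interpolation c10 c1'0 c20 c2'0 a0 ab m10 m20 k0.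
have [t2 t20 Hstep] := window_weight_step c1'0 c2'0 m20 mu0 g0 q0 q1 munu.
have [t3 t30 Hinit] := window_weight_init c1'0 g0 q0 q1 muC.
rewrite -/g -/mu -/nu in Hint.
(* The three thresholds serve the choice of the frequency, the comparison of consecutive weights and
   the first weight. *)
exists ((1 - q) / 4), (Num.min t1 (Num.min t2 t3)).
split; [by rewrite divr_gt0|by rewrite !lt_min t10 t20|].
move=> E s L X phi mE L0; rewrite !le_min => /and3P[Lt1 Lt2 Lt3] dE X0 phi0 Xni HX.
have l0 m : 0 < q ^+ m * L by rewrite mulr_gt0// exprn_gt0.
pose tau (m : nat) : R := (1 - q) * (q ^+ m * L); pose l (m : nat) : R := s + q ^+ m * L.
have tau0 m : 0 < tau m by rewrite mulr_gt0.
have lE m : l m = l m.+1 + tau m by rewrite /l /tau exprS; ring.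
have tauS m : tau m.+1 = q * tau m by rewrite /tau exprS; ring.
have sl m : s <= l m by rewrite lerDl ltW.
have lL m : l m <= s + L.
  by rewrite lerD2l ler_piMl ?(ltW L0)// exprn_ile1 ?(ltW q0) ?(ltW q1).
have tauL m : tau m <= L.
  by have := lE m; have := lL m; have := sl m.+1; lra.
pose A m := spectral_cost c1' mu g (tau m).
pose B m := (1 + A m) * dissipation_rate c2' m2 nu g (tau m).
pose w m := window_weight c1' mu g (tau m).
have wE m : w m = tau m / (8 * A m ^+ 2) by [].
have A0 m : 0 < A m by apply: spectral_cost_gt0.
have Ac m : c1' <= A m.
  rewrite -[leLHS]mulr1 ler_pM2l// -expR0 ler_expR.
  by rewrite mulr_ge0 ?powR_ge0// ltW.
have w0 m : 0 < w m by apply: window_weight_gt0.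
have wS m : 2 * B m ^+ 2 * w m <= w m.+1.
  by rewrite /w tauS; apply: Hstep => //; apply: le_trans Lt2.
(* The window inequality solved for the squared observation. Truncation at [0] keeps the step
   function nonnegative. *)
pose c (m : nat) : R := Num.max 0 ((X (l m) ^+ 2 - 2 * B m ^+ 2 * X (l m.+1) ^+ 2) /
                       (2 * A m ^+ 2)).
have c0 m : 0 <= c m by rewrite le_max lexx.
have cphi m t : E t -> s + q ^+ m.+1 * L + (1 - q) * (q ^+ m * L) / 2 <= t ->
    t < s + q ^+ m * L -> c m <= phi t ^+ 2.
  rewrite -/(tau m) -/(l m) -/(l m.+1) => Et lt tl.
  have tm := tau0 m.
  have A2 : 0 < 2 * A m ^+ 2 by apply: mulr_gt0 => //; apply: exprn_gt0.
  rewrite ge_max sqr_ge0/= ler_pdivrMr//.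
  rewrite lerBlDr [leRHS](_ : _ = 2 * A m ^+ 2 * phi t ^+ 2 +
    2 * B m ^+ 2 * X (l m.+1) ^+ 2); last by ring.
  (* Monotonicity passes from the top of the window down to [t]; the interpolation then compares [t]
     with the bottom, at least half a window earlier. *)
  apply: le_sqr_affine => //; apply: (@le_trans _ _ (X t)).
    apply: Xni => //; last exact: ltW.
    by apply: le_trans lt; have := sl m.+1; lra.
  apply: (Hint _ (t - l m.+1)) => //; [exact: le_trans Lt1|lra|].
  move=> j j1; apply: HX => //; first by lra.
  exact: lt_le_trans (lL m).
have Hsum := telescoping_integral q0 q1 L0 (lexx _) mE
  (fun t => sqr_ge0 (phi t)) dE c0 cphi.
set I := (X in (_ <= _ * X)%E).
(* The remainder after [N] windows is at most [q ^ N * K], because every cost is at least [c1'] and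
   [X] never exceeds [X s] on the grid. *)
pose K := (1 - q) * L / (8 * c1' ^+ 2) * X s ^+ 2.
have Hw N : ((w 0%N * X (l 0%N) ^+ 2 - q ^+ N * K)%:E <= I)%E.
  apply: le_trans (Hsum N); rewrite sumEFin lee_fin.
  apply: (@le_trans _ _ (w 0%N * X (l 0%N) ^+ 2 - w N * X (l N) ^+ 2)).
    rewrite lerD2l lerN2.
    apply: (@le_trans _ _ (tau N / (8 * c1' ^+ 2) * X s ^+ 2)); last first.
      by rewrite le_eqVlt /K /tau; apply/orP; left; apply/eqP; ring.
    apply: ler_pM; rewrite ?sqr_ge0//; first exact: ltW.
      rewrite (wE N); apply: ler_wpM2l; first exact: ltW.
      rewrite lef_pV2; first by rewrite ler_pM2l// lerXn2r// nnegrE ltW.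
        by rewrite posrE mulr_gt0// exprn_gt0 //.
      by rewrite posrE mulr_gt0// exprn_gt0.
    by rewrite lerXn2r ?nnegrE//; apply: Xni.
  elim: N => [|N IH]; first by rewrite big_ord0 subrr.
  rewrite big_ord_recr /= -lerBlDr; apply: le_trans IH.
  have : w N * (X (l N) ^+ 2 - 2 * B N ^+ 2 * X (l N.+1) ^+ 2) <= tau N / 4 * c N.
    have -> : w N = tau N / 4 * (2 * A N ^+ 2)^-1.
      by rewrite wE; field; rewrite gt_eqF.
    by rewrite -mulrA ler_pM2l ?divr_gt0// mulrC le_max lexx orbT.
  move=> /weighted_step/(_ (wS N) (sqr_ge0 _)); exact.
have {}Hw : ((w 0%N * X (l 0%N) ^+ 2)%:E <= I)%E.
  (* The integral may be infinite, in which case the bound is trivial; otherwise [N] tends to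
     infinity. *)
  case: I Hw => [i Hi|_|/(_ 0%N)//]; last exact: leey.
  by rewrite lee_fin; apply: (@geometric_tail_le _ q K).
have wi := Hinit L L0 Lt3.
have l0E : l 0%N = s + L by rewrite /l expr0 mul1r.
have tau0E : tau 0%N = (1 - q) * L by rewrite /tau expr0 mul1r.
apply: (@le_trans _ _ ((expR (C / L `^ g))%:E * (w 0%N * X (l 0%N) ^+ 2)%:E)%E).
  rewrite -EFinM lee_fin l0E mulrA /w tau0E.
  by apply: ler_peMl => //; exact: sqr_ge0.
by apply: lee_wpmul2l => //; rewrite lee_fin expR_ge0.
Qed.

(** * Norms on the control support *)

Section localized_norm.
Context d (T : measurableType d) (R : realType).
Variables (mu : {measure set T -> \bar R}) (k : scalar_field).
Variables (B : set T) (mB : measurable B).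
Implicit Types f g : L2 mu k.

Local Notation local_norm f :=
  (Lnorm mu 2%:E (fun x => (modulus (repr f x) * \1_B x)%:E)).

Lemma measurable_modulus_indic (f : L2fun mu k) :
  measurable_fun setT (fun x => modulus (f x) * \1_B x).
Proof.
apply: measurable_funM; first exact: measurable_modulus (valP f).
exact: measurable_indic.
Qed.

Lemma local_norm_le f : (local_norm f <= `|f|%:E)%E.
Proof.
rewrite [X in (_ <= X)%E]L2normE; apply: le_Lnorm2.
- exact: measurable_modulus_indic.
- exact: measurable_modulus (valP (repr f)).
- move=> x; rewrite mulr_ge0 ?modulus_ge0//= ler_piMr ?modulus_ge0//.
Qed.

Lemma local_normD f g : (local_norm (f + g) <= local_norm f + local_norm g)%E.
Proof.
(* The chosen representative of [f + g] is the sum of the representatives only almost everywhere. *)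
rewrite [X in (X <= _)%E](_ : _ = Lnorm mu 2%:E
    (fun x => (modulus ((repr f + repr g : L2fun mu k) x) * \1_B x)%:E)); last first.
  rewrite unlock; congr poweR; apply: ae_eq_integral => //.
  - apply: (measurableT_comp (measurable_poweR _)).
    apply: measurableT_comp => //; apply/measurable_EFinP.
    exact: measurable_modulus_indic.
  - apply: (measurableT_comp (measurable_poweR _)).
    apply: measurableT_comp => //; apply/measurable_EFinP.
    exact: measurable_modulus_indic.
  by apply: filterS (reprD f g) => x fgx _; rewrite fgx L2funD.
apply: (@le_trans _ _ (Lnorm mu 2%:E (EFin \o
    ((fun x => modulus (repr f x) * \1_B x) \+
     (fun x => modulus (repr g x) * \1_B x))))).
  apply: le_Lnorm2.
  - exact: measurable_modulus_indic.
  - by apply: measurable_funD; exact: measurable_modulus_indic.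
  - move=> x; rewrite mulr_ge0 ?modulus_ge0//= -mulrDl ler_wpM2r//.
    exact: modulusD.
apply: eminkowski; [exact: measurable_modulus_indic..|by rewrite lee_fin ler1n].
Qed.

End localized_norm.

Section norm_on.
Context (R : realType) (n : nat) (Omega : set 'rV[R]_n.+1).
Variables (oOmega : open Omega) (k : scalar_field) (A : set 'rV[R]_n.+1).
Implicit Types f g : L2Omega oOmega k.

Lemma norm_on_ge0 f : 0 <= norm_on A f.
Proof. by rewrite fine_ge0// Lnorm_ge0. Qed.

Hypothesis mA : measurable (Omega `&` A : set (lebesgue_space R n)).

Lemma norm_onE f : (norm_on A f)%:E = Lnorm (lebesgue_on oOmega) 2%:E
  (fun x => (modulus (repr f x) * \1_(Omega `&` A) x)%:E).
Proof.
rewrite fineK// ge0_fin_numE ?Lnorm_ge0//.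
exact: le_lt_trans (local_norm_le mA f) (ltry _).
Qed.

Lemma norm_on_le f : norm_on A f <= `|f|.
Proof. by rewrite -lee_fin norm_onE local_norm_le. Qed.

Lemma norm_onD f g : norm_on A (f + g) <= norm_on A f + norm_on A g.
Proof. by rewrite -lee_fin EFinD !norm_onE; exact: local_normD. Qed.

(** The triangle inequality is used twice: globally to split [v] into [P v] and [v - P v], and on
    [A] to return from [P v] to [v]. Each use costs one [D], the second multiplied by [S]. *)
Lemma spectral_interpolation (P : {linear L2Omega oOmega k -> L2Omega oOmega k})
    (S D : R) (v : L2Omega oOmega k) : 0 <= S ->
  `|P v| <= S * norm_on A (P v) -> `|v - P v| <= D ->
  `|v| <= S * norm_on A v + (1 + S) * D.
Proof.
move=> S0 PS vD.
have vP : norm_on A (P v) <= norm_on A v + D.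
  have := norm_onD v (P v - v); rewrite addrC subrK => /le_trans; apply.
  by rewrite lerD2l (le_trans (norm_on_le _))// distrC.
have : `|v| <= `|P v| + `|v - P v|.
  by rewrite -[in leLHS](subrK (P v) v) addrC ler_normD.
have := ler_wpM2l S0 vP.
by lra.
Qed.

End norm_on.

(** All sections of a set measurable for the product sigma-algebra are measurable, so the conclusion
    holds at every time and not only almost everywhere. *)
Lemma measurable_control_section (R : realType) (n : nat) (T : R)
    (Omega : set 'rV[R]_n.+1) (omega : R -> set 'rV[R]_n.+1) (t : R) :
  open Omega -> moving_control_support T Omega omega -> 0 <= t -> t <= T ->
  measurable (Omega `&` omega t : set (lebesgue_space R n)).
Proof.
move=> oOmega momega t0 tT.
have mD : measurable (`[0, T]%classic `*` Omega :
    set (lebesgue_line R * lebesgue_space R n)).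
  by apply: measurableX; [exact: measurable_line|exact: open_lebesgue_measurable].
have mOt := momega mD [set 1] (measurable_set1 _).
suff -> : Omega `&` omega t = xsection ((`[0, T]%classic `*` Omega) `&`
    (fun p => \1_(omega p.1) p.2) @^-1` [set (1 : R)]) t.
  exact: (@measurable_xsection _ _ (lebesgue_line R) (lebesgue_space R n) _ t).
apply/seteqP; split=> x.
  move=> [Ox wx]; rewrite /xsection /= inE /=; split.
    by rewrite in_itv /= t0.
  by rewrite indicE mem_set.
rewrite /xsection /= inE /= => -[[_ Ox]]; rewrite indicE.
by case: (boolP (x \in omega t)) => [/set_mem//|_ /eqP]; rewrite eq_sym oner_eq0.
Qed.

(** * From the scalar inequality to the evolution system *)

(** Contractivity makes the norm of the state nonincreasing, and the spectral and dissipation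
    estimates give the interpolation bound. [eps] and [L0] precede the domain, the operators and the
    time interval, so that one [T0] can serve them all. *)
Lemma evolution_observability (R : realType) (K : scalar_field) (n : nat)
    (c1 c1' c2 c2' a b m1 m2 C : R) :
  0 < c1 -> 0 < c1' -> 0 < c2 -> 0 < c2' -> 0 < a -> a < b -> 0 < m1 ->
  0 <= m2 ->
  let g := a * m1 / (b - a) in
  let beta := 2 * g + a * b * m1 / (b - a) ^+ 2 in
  let alpha := g + 1 + a + a ^+ 2 / (b - a) in
  c1 `^ (b / (b - a)) * c2 `^ (- (a / (b - a))) *
    (2 `^ alpha * beta `^ beta / (g `^ g * (beta - g) `^ (beta - g))) < C ->
  exists eps L0 : R, [/\ 0 < eps, 0 < L0 &
    forall (Omega : set 'rV[R]_n.+1) (oOmega : open Omega) (T : R)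
      (omega : R -> set 'rV[R]_n.+1)
      (P : nat -> {linear L2Omega oOmega K -> L2Omega oOmega K})
      (U : R -> R -> {linear L2Omega oOmega K -> L2Omega oOmega K})
      (delta1 delta2 : R) (E : set (lebesgue_line R)) (s L : R),
    moving_control_support T Omega omega ->
    evolution_system_of_contractions T U ->
    0 <= delta1 -> delta2 <= T ->
    measurable E -> E `<=` `[delta1, delta2]%classic ->
    uniform_spectral_estimates E omega P c1 c1' a ->
    dissipation_estimates delta1 delta2 U P c2 c2' m1 m2 b ->
    delta1 <= s -> s + L <= delta2 -> 0 < L -> L <= L0 ->
    (forall r, 0 < r -> r <= L ->
      (line_measure R (`]s, (s + r)%R[%classic `\` E) <= (eps * r)%:E)%E) ->
    forall h : L2Omega oOmega K,
    ((`|U (s + L) s h| ^+ 2)%:E <= (expR (C / L `^ g))%:E *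
      \int[line_measure R]_(t in `]s, (s + L)%R[%classic `&` E)
        (norm_on (omega t) (U t s h) ^+ 2)%:E)%E].
Proof.
move=> c10 c1'0 c20 c2'0 a0 ab m10 m20 g beta alpha HC.
have [eps [L0 [eps0 L00 HO]]] :=
  scalar_observability c10 c1'0 c20 c2'0 a0 ab m10 m20 HC.
exists eps, L0; split=> // Omega oOmega T omega P U delta1 delta2 E s L.
move=> momega [_ Ucomp _ Ucontr] d10 d2T mE Ed HP HU ds sd L_gt0 LL0 dE h.
apply: (HO E s L (fun t => `|U t s h|) (fun t => norm_on (omega t) (U t s h)))
  => //.
- by move=> t; exact: norm_on_ge0.
- move=> u t su ut tL; have tT : t <= T by lra.
  have u0 : 0 <= u by lra.
  by rewrite -(Ucomp s u t)//; [exact: Ucontr|lra].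
move=> u t j j1 su ut tL Et.
have tT : t <= T by lra.
(* Restarting at [u] makes the dissipation act on the datum [U u s h] during the time [t - u]. *)
have -> : U t s h = U t u (U u s h) by rewrite (Ucomp s u t)//; lra.
rewrite -(mulrA (1 + _)); apply: (@spectral_interpolation _ _ _ _ _ _ _ (P j)).
- by apply: measurable_control_section momega _ _ => //; lra.
- by rewrite mulr_ge0 ?expR_ge0// ltW.
- exact: HP.
- by apply: HU => //; lra.
Qed.

(** * Density points, the full time interval and the explicit constant *)

(** If [E] avoided the interval, the missed part would have measure [r], which exceeds [eps * r]. *)
Lemma density_point_meets (R : realType) (E : set (lebesgue_line R))
    (s r eps : R) :
  0 < r -> eps < 1 ->
  (line_measure R (`]s, (s + r)%R[%classic `\` E) <= (eps * r)%:E)%E ->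
  exists2 t, s < t < s + r & E t.
Proof.
move=> r0 e1; apply: contraPP => nE; apply/negP; rewrite -ltNge.
rewrite (_ : _ `\` _ = `]s, (s + r)%R[%classic); last first.
  apply/seteqP; split=> [t []//|t /= st]; split=> // Et; apply: nE.
  by exists t => //; move: st; rewrite in_itv.
rewrite line_measureE lebesgue_measure_itv /= lte_fin ltrDl r0.
by rewrite -EFinB lte_fin addrAC subrr add0r gtr_pMl.
Qed.

Theorem theorem3p2 (R : realType) (K : scalar_field) (n : nat)
  (c1 c1' c2 c2' a b m1 m2 : R)
  (c1_gt0 : 0 < c1) (c1'_gt0 : 0 < c1') (c2_gt0 : 0 < c2) (c2'_gt0 : 0 < c2')
  (a_gt0 : 0 < a) (b_gt0 : 0 < b) (ab : a < b) (m1_gt0 : 0 < m1)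
  (m2_ge0 : 0 <= m2) :
  (forall (Omega : set 'rV[R]_n.+1) (oOmega : open Omega) (T : R)
     (omega : R -> set 'rV[R]_n.+1)
     (P : nat -> {linear L2Omega oOmega K -> L2Omega oOmega K})
     (U : R -> R -> {linear L2Omega oOmega K -> L2Omega oOmega K})
     (delta1 delta2 : R) (E : set (lebesgue_line R)),
   0 < T ->
   moving_control_support T Omega omega ->
   (forall k, (1 <= k)%N -> orthogonal_projection (P k)) ->
   evolution_system_of_contractions T U ->
   0 <= delta1 -> delta1 < delta2 -> delta2 <= T ->
   measurable E -> E `<=` `[delta1, delta2]%classic ->
   (0 < line_measure R E)%E ->
   uniform_spectral_estimates E omega P c1 c1' a ->
   dissipation_estimates delta1 delta2 U P c2 c2' m1 m2 b ->
   (exists C : R, 0 < C /\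
      {ae line_measure R, forall tstar, E tstar ->
        forall r : R, 0 < r ->
        exists t0 : R, [/\ tstar < t0, t0 < tstar + r, E t0 &
        forall g : L2Omega oOmega K,
        ((`|U t0 tstar g| ^+ 2)%:E <=
         (expR (C / (t0 - tstar) `^ (a * m1 / (b - a))))%:E *
         \int[line_measure R]_(t in `]tstar, t0[%classic `&` E)
           (norm_on (omega t) (U t tstar g) ^+ 2)%:E)%E]}) /\
   (exists C1 : R, 0 < C1 /\
      forall g : L2Omega oOmega K,
      ((`|U T 0 g| ^+ 2)%:E <=
       C1%:E * \int[line_measure R]_(t in E)
         (norm_on (omega t) (U t 0 g) ^+ 2)%:E)%E)) /\
  (let gamma := a * m1 / (b - a) in
   let beta := 2 * gamma + a * b * m1 / (b - a) ^+ 2 in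
   let alpha := gamma + 1 + a + a ^+ 2 / (b - a) in
   forall C : R, 0 < C ->
   c1 `^ (b / (b - a)) * c2 `^ (- (a / (b - a))) *
     (2 `^ alpha * beta `^ beta /
       (gamma `^ gamma * (beta - gamma) `^ (beta - gamma))) < C ->
   exists T0 : R, 0 < T0 /\
   forall (Omega : set 'rV[R]_n.+1) (oOmega : open Omega) (T : R)
     (omega : R -> set 'rV[R]_n.+1)
     (P : nat -> {linear L2Omega oOmega K -> L2Omega oOmega K})
     (U : R -> R -> {linear L2Omega oOmega K -> L2Omega oOmega K}),
   0 < T -> T <= T0 ->
   moving_control_support T Omega omega ->
   (forall k, (1 <= k)%N -> orthogonal_projection (P k)) ->
   evolution_system_of_contractions T U ->
   uniform_spectral_estimates `[0, T]%classic omega P c1 c1' a ->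
   dissipation_estimates 0 T U P c2 c2' m1 m2 b ->
   forall g : L2Omega oOmega K,
   ((`|U T 0 g| ^+ 2)%:E <=
    (expR (C / T `^ (a * m1 / (b - a))))%:E *
    \int[line_measure R]_(t in `[0%R, T]%classic)
      (norm_on (omega t) (U t 0 g) ^+ 2)%:E)%E).
Proof.
set g := a * m1 / (b - a).
split.
  move=> Omega oOmega T omega P U delta1 delta2 E T0 momega _ evU d10 d12 d2T mE Ed
    E0 HP HU.
  set target := c1 `^ (b / (b - a)) * c2 `^ (- (a / (b - a))) *
    (2 `^ (g + 1 + a + a ^+ 2 / (b - a)) *
     (2 * g + a * b * m1 / (b - a) ^+ 2) `^ (2 * g + a * b * m1 / (b - a) ^+ 2) /
     (g `^ g * (2 * g + a * b * m1 / (b - a) ^+ 2 - g) `^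
        (2 * g + a * b * m1 / (b - a) ^+ 2 - g))).
  (* Any constant above the threshold serves here; the maximum with [0] gives positivity at once. *)
  pose C := Num.max 0 target + 1.
  have C0 : 0 < C by rewrite ltr_pwDr// le_max lexx.
  have targetC : target < C by rewrite ltr_pwDr// le_max lexx orbT.
  have [eps [L0 [eps0 L00 obs]]] := @evolution_observability R K n _ _ _ _ _ _ _ _ _
    c1_gt0 c1'_gt0 c2_gt0 c2'_gt0 a_gt0 ab m1_gt0 m2_ge0 targetC.
  clearbody target C; clear targetC target.
  (* A bound below [1] is what forces [E] to meet every short interval to the right of a density
     point. *)
  pose e := Num.min eps (1 / 2).
  have e0 : 0 < e by rewrite lt_min eps0 divr_gt0.
  have eeps : e <= eps by rewrite ge_min lexx.
  have e1 : e < 1 by apply: (@le_lt_trans _ _ (1 / 2)); [rewrite ge_min lexx orbT|lra].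
  have window : {ae line_measure R, forall tstar, E tstar ->
      forall r : R, 0 < r ->
      exists t0 : R, [/\ tstar < t0, t0 < tstar + r, E t0 &
      forall h : L2Omega oOmega K,
      ((`|U t0 tstar h| ^+ 2)%:E <= (expR (C / (t0 - tstar) `^ g))%:E *
       \int[line_measure R]_(t in `]tstar, t0[%classic `&` E)
         (norm_on (omega t) (U t tstar h) ^+ 2)%:E)%E]}.
    apply: filterS (density_right mE e0) => s Hs Es r r_gt0.
    have [r0 r0_gt0 dE] := Hs Es.
    pose rho := Num.min r (Num.min r0 L0).
    have rho0 : 0 < rho by rewrite !lt_min r_gt0 r0_gt0.
    have [rhor rhor0 rhoL] : [/\ rho <= r, rho <= r0 & rho <= L0].
      by rewrite !ge_min !lexx !orbT.
    (* [rho] is at most [r], the density radius and [L0], so the window from [s] to [t0] is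
       admissible. *)
    have [t0 /andP[st ts] Et] := density_point_meets rho0 e1 (dE _ rho0 rhor0).
    exists t0; split=> //; first by lra.
    have -> : t0 = s + (t0 - s) by rewrite addrC subrK.
    rewrite [s + _ - _]addrAC subrr add0r.
    have := Ed _ Et; have := Ed _ Es; rewrite /= !in_itv /= => /andP[ds _] /andP[_ td].
    apply: (obs Omega oOmega T omega P U delta1 delta2 E) => //; try lra.
    move=> x x0 xL; apply: le_trans (dE x x0 _) _; first by lra.
    by rewrite lee_fin ler_pM2r.
  split; first by exists C.
  have [s [Es Hs]] : exists s, E s /\ (E s -> forall r : R, 0 < r ->
      exists t0 : R, [/\ s < t0, t0 < s + r, E t0 &
      forall h : L2Omega oOmega K,
      ((`|U t0 s h| ^+ 2)%:E <= (expR (C / (t0 - s) `^ g))%:E *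
       \int[line_measure R]_(t in `]s, t0[%classic `&` E)
         (norm_on (omega t) (U t s h) ^+ 2)%:E)%E]).
    (* Otherwise [E] would lie in the null exceptional set, against its positive measure. *)
    apply: contrapT => nE; case: window => N [mN N0 HN].
    move: E0; apply/negP; rewrite -leNgt -N0; apply: le_measure; rewrite ?inE//.
    by move=> s Es; apply: HN => /= Hs; apply: nE; exists s.
  have [t0 [st _ Et obs0]] := Hs Es 1 ltr01.
  exists (expR (C / (t0 - s) `^ g)); split; first exact: expR_gt0.
  move=> h; have [U1 Ucomp _ Ucontr] := evU.
  have := Ed _ Et; have := Ed _ Es; rewrite /= !in_itv /= => /andP[ds sd] /andP[dt td].
  have s0 : 0 <= s by lra.
  have t0T : t0 <= T by lra.
  have t00 : 0 <= t0 by lra.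
  (* Contractivity from [t0] to [T] reduces the claim to the window from [s] to [t0], applied to the
     datum [U s 0 h]. *)
  apply: (@le_trans _ _ (`|U t0 s (U s 0 h)| ^+ 2)%:E).
    rewrite lee_fin lerXn2r ?nnegrE// (Ucomp 0 s t0)//; last exact: ltW.
    by rewrite -(Ucomp 0 t0 T)//; exact: Ucontr.
  apply: le_trans (obs0 _) _; apply: lee_wpmul2l; first by rewrite lee_fin expR_ge0.
  apply: le_integral_restrict; first by move=> t [].
    by move=> t _; rewrite lee_fin sqr_ge0.
  move=> t [/= + Et']; rewrite in_itv /= => /andP[st' _].
  have := Ed _ Et'; rewrite /= in_itv /= => /andP[_ td'].
  by rewrite lee_fin sqr_ge0 (Ucomp 0 s t)//=; lra.
move=> gamma beta alpha C C0 HC.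
have [eps [L0 [eps0 L00 obs]]] := @evolution_observability R K n _ _ _ _ _ _ _ _ _
    c1_gt0 c1'_gt0 c2_gt0 c2'_gt0 a_gt0 ab m1_gt0 m2_ge0 HC.
exists L0; split=> // Omega oOmega T omega P U T0 TL momega _ evU HP HU h.
(* The whole interval is taken as a single window with [s = 0] and [L = T]; [E] fills it, so the
   missed set is empty. *)
have := obs Omega oOmega T omega P U 0 T `[0, T]%classic 0 T momega evU (lexx 0)
  (lexx T) _ (@subset_refl _ _) HP HU (lexx 0) _ T0 TL.
rewrite add0r => /(_ _ (lexx T) _ h) H.
apply: le_trans (H _ _) _.
- exact: measurable_line.
- move=> r r0 rT; rewrite add0r (_ : _ `\` _ = set0).
    by rewrite measure0 lee_fin mulr_ge0// ltW.
  apply/seteqP; split=> // t [] /=; rewrite !in_itv /= => /andP[t0 tr].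
  by rewrite (ltW t0)/= (ltW (lt_le_trans tr rT)).
apply: lee_wpmul2l; first by rewrite lee_fin expR_ge0.
apply: le_integral_restrict; first by move=> t [].
  by move=> t _; rewrite lee_fin sqr_ge0.
by move=> t _; rewrite lee_fin sqr_ge0 lexx.
Qed.
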